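(* Let $\vec{R} = (R_n : n \in \omega)$ be a computable sequence of subsets of $\omega$ such that there is no computable $\vec{R}$-cohesive set. Then there exists a Martin-L\''{o}f random set $X \subseteq \omega$ which computes no $\vec{R}$-cohesive set; that is, there is no $\vec{R}$-cohesive set $C$ with $C \leq_T X$.
   Context: A sequence $\vec{R} = (R_n : n\in\omega)$ of subsets of $\omega$ is computable if it is uniformly computable, i.e. the relation $\{(n,x) : x \in R_n\}$ is computable. For sets $X,Y$, write $X \subseteq^* Y$ if $X - Y$ is finite. An infinite set $X \subseteq \omega$ is $\vec{R}$-cohesive if for every $n$ either $X \subseteq^* R_n$ or $X \subseteq^* \omega - R_n$. Martin-L\''{o}f randomness is with respect to the canonical Lebesgue measure on Cantor space $2^\omega$. *)

(* Defs.v *)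
From Stdlib Require List.
From mathcomp Require Import all_boot all_order all_algebra.
From mathcomp Require Import all_classical all_reals all_analysis.

Set Implicit Arguments.
Unset Strict Implicit.
Unset Printing Implicit Defensive.

Import Order.TTheory GRing.Theory Num.Theory.
Import numFieldNormedType.Exports.

Local Open Scope classical_set_scope.
Local Open Scope ring_scope.

(* Subsets of omega, i.e. points of Cantor space, are functions nat -> bool. *)

(* Programs for the functions on nat that are partial recursive relative to an
   oracle. Codes have no fixed arity: a missing argument is read as 0. *)
Inductive code : Type :=
| Zero
| Succ
| Proj of nat
| Oracle
| Comp of code & seq code
| PrimRec of code & code
| Mu of code.

(* [eval A c xs y]: the program c with oracle A halts on input xs with output
   y. PrimRec recurses on the first argument; Mu searches for the least value
   of a new first argument at which c vanishes, c being defined at all smaller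
   values. *)
Fixpoint eval (A : nat -> bool) (c : code) (xs : seq nat) (y : nat) : Prop :=
  match c with
  | Zero => y = 0%N
  | Succ => y = (nth 0%N xs 0).+1
  | Proj i => y = nth 0%N xs i
  | Oracle => y = A (nth 0%N xs 0)
  | Comp f gs =>
      exists2 ys : seq nat,
        List.Forall2 (fun (P : nat -> Prop) v => P v)
          [seq eval A g xs | g <- gs] ys
        & eval A f ys y
  | PrimRec f g =>
      exists v : nat -> nat,
        [/\ eval A f (behead xs) (v 0%N),
            forall i, (i < nth 0 xs 0)%N ->
              eval A g [:: i, v i & behead xs] (v i.+1)
          & y = v (nth 0%N xs 0)]
  | Mu f =>
      eval A f (y :: xs) 0%N /\
      forall z, (z < y)%N -> exists v, eval A f (z :: xs) v.+1
  end.

Definition turing_reducible (C X : nat -> bool) : Prop :=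
  exists c : code, forall x, eval X c [:: x] (C x).

(* Absolute computability is computability with the empty oracle. *)
Definition empty_oracle : nat -> bool := fun=> false.

Definition computable_set (C : nat -> bool) : Prop :=
  exists c : code, forall x, eval empty_oracle c [:: x] (C x).

Definition computable_sequence (R : nat -> nat -> bool) : Prop :=
  exists c : code, forall n x, eval empty_oracle c [:: n; x] (R n x).

Definition almost_subset (X Y : set nat) : Prop := finite_set (X `\` Y).

Definition cohesive (R : nat -> nat -> bool) (X : nat -> bool) : Prop :=
  infinite_set [set x | X x] /\
  forall n, almost_subset [set x | X x] [set x | R n x] \/
            almost_subset [set x | X x] (~` [set x | R n x]).

(* Bijective base 2 numeration (digits 1 and 2), least significant digit
   first: a computable bijection from binary strings onto nat. *)
Definition string_code (s : seq bool) : nat :=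
  foldr (fun (b : bool) n => (n.*2 + b.+1)%N) 0%N s.

Definition uniformly_ce (W : nat -> seq bool -> Prop) : Prop :=
  exists c : code, forall n s,
    W n s <-> exists y, eval empty_oracle c [:: n; string_code s] y.

Definition cylinder (s : seq bool) : set (nat -> bool) :=
  [set X | forall i, (i < size s)%N -> X i = nth false s i].

Definition open_of (W : seq bool -> Prop) : set (nat -> bool) :=
  \bigcup_(s in W) cylinder s.

(* The binary expansion of x in [0, 1[ (not eventually 1). *)
Definition binary_digits (K : realType) (x : K) : nat -> bool :=
  fun n => odd (Num.truncn (2 ^+ n.+1 * x)).

(* Lebesgue measure on Cantor space, obtained from Lebesgue measure on [0, 1[
   through binary expansions. *)
Definition cantor_measure (K : realType) (A : set (nat -> bool)) : \bar K :=
  lebesgue_measure ([set x : K | 0 <= x < 1] `&` @binary_digits K @^-1` A).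

Definition martin_lof_test (K : realType) (W : nat -> seq bool -> Prop) :
    Prop :=
  uniformly_ce W /\
  forall n, (cantor_measure K (open_of (W n)) <= (2^-1 ^+ n)%:E)%E.

Definition martin_lof_random (K : realType) (X : nat -> bool) : Prop :=
  forall W, martin_lof_test K W -> ~ (\bigcap_n open_of (W n)) X.

Lemma string_code_bij : bijective string_code.
Proof.
have inj : injective string_code.
  elim=> [|b s IH] [|b' s'] //=.
  - by rewrite addnS.
  - by rewrite addnS.
  - move=> e; have eb : b = b'.
      move: (congr1 odd e); rewrite !oddD !odd_double /=.
      by case: b b' {e} => [] [].
    rewrite -eb in e *; move/addIn: e => /(congr1 half).
    by rewrite !doubleK => /IH ->.
have sur : forall n, exists s, string_code s = n.
  elim/ltn_ind => -[_|n IH]; first by exists [::].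
  have lt_half : (n./2 < n.+1)%N.
    by rewrite ltnS leq_half_double -addnn -addnS leq_addr.
  have [s es] := IH _ lt_half.
  exists (odd n :: s) => /=.
  by rewrite es addnS addnC odd_double_half.
have [g gP] := choice sur.
by exists g => // s; apply: inj; rewrite gP.
Qed.

Lemma truncn_double (K : realType) (y : K) :
  0 <= y ->
  Num.truncn (2 * y) = ((Num.truncn y).*2 + odd (Num.truncn (2 * y)))%N.
Proof.
move=> y0; suff <- : (Num.truncn (2 * y))./2 = Num.truncn y.
  by rewrite addnC odd_double_half.
set m := Num.truncn (2 * y); apply/esym/truncn_def.
have /andP[m1 m2] : m%:R <= 2 * y < m.+1%:R.
  by apply: truncn_itv; rewrite mulr_ge0.
have e := odd_double_half m.
have ->: y = (2 * y) / 2 by rewrite mulrC mulKf.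
rewrite ler_pdivlMr // ltr_pdivrMr // -!natrM !muln2; apply/andP; split.
  by apply: le_trans m1; rewrite ler_nat -{2}e leq_addl.
by apply: lt_le_trans m2 _; rewrite ler_nat doubleS -{1}e; case: (odd m).
Qed.

Lemma cantor_measure_cylinder (K : realType) (s : seq bool) :
  cantor_measure K (cylinder s) = (2^-1 ^+ size s)%:E.
Proof.
pose val (s : seq bool) := foldl (fun k (b : bool) => (k.*2 + b)%N) 0%N s.
have val_lt : (val s < 2 ^ size s)%N.
  elim/last_ind: s => // s b IH.
  rewrite /val foldl_rcons -/(val s) size_rcons expnS mul2n.
  by rewrite -ltn_half_double halfD odd_double doubleK /=; case: b; rewrite !addn0.
have cyl (x : K) : 0 <= x < 1 ->
    cylinder s (binary_digits x) <-> Num.truncn (2 ^+ size s * x) = val s.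
  move=> /andP[x0 x1]; elim/last_ind: s {val_lt} => [|s b IH].
    rewrite mul1r; split=> // _.
    by apply: truncn_def; rewrite x0.
  rewrite /val foldl_rcons -/(val s) size_rcons exprS -mulrA.
  have y0 : 0 <= 2 ^+ size s * x by rewrite mulr_ge0 // exprn_ge0.
  split=> [H|].
    rewrite truncn_double //; congr (_.*2 + _)%N.
      apply/IH => i lis; rewrite H ?size_rcons 1?ltnW ?ltnS //.
      by rewrite nth_rcons lis.
    have := H (size s); rewrite size_rcons ltnSn nth_rcons ltnn eqxx => /(_ isT).
    by rewrite /binary_digits exprS -mulrA => ->.
  move=> e; have eb : odd (Num.truncn (2 * (2 ^+ size s * x))) = b.
    by rewrite e oddD odd_double oddb.
  move: e; rewrite truncn_double // eb => /addIn /(congr1 half).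
  rewrite !doubleK => /IH H i; rewrite size_rcons ltnS leq_eqVlt nth_rcons.
  case/predU1P => [->|lis]; last by rewrite lis; apply: H.
  by rewrite ltnn eqxx /binary_digits exprS -mulrA.
have p0 : 0 < 2 ^+ size s :> K by rewrite exprn_gt0.
rewrite /cantor_measure.
have -> : [set x : K | 0 <= x < 1] `&` @binary_digits K @^-1` cylinder s =
    [set` `[(val s)%:R / 2 ^+ size s, (val s).+1%:R / 2 ^+ size s[].
  apply/seteqP; split=> x /=; rewrite in_itv /= ler_pdivrMr // ltr_pdivlMr //.
    move=> [xI /(cyl _ xI) <-]; rewrite mulrC; apply: truncn_itv.
    by case/andP: xI => x0 _; rewrite mulr_ge0 // ltW.
  move=> /andP[x1 x2].
  have xI : 0 <= x < 1.
    apply/andP; split.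
      by rewrite -(pmulr_lge0 x p0) (le_trans _ x1).
    rewrite -(ltr_pM2r p0) mul1r (lt_le_trans x2) //.
    by rewrite -natrX ler_nat.
  by split=> //; apply/(cyl _ xI); apply: truncn_def; rewrite mulrC x1.
rewrite lebesgue_measure_itv /= lte_fin ltr_pM2r ?invr_gt0 // ltr_nat ltnSn.
by rewrite -EFinB -mulrBl -natrB // subSnn mul1r exprVn.
Qed.

(* Main.v *)
(* Take an effectively closed class of Martin-Löf random sets and shrink it by
   one program e at a time, so that no member of the new class computes a
   cohesive set via e; by compactness the classes obtained have a common member.

   Suppose that a class B cannot be shrunk for e, i.e. every nonempty
   effectively closed subclass of B has a member that computes a cohesive set
   via e. For n = 0, 1, ... pass to the subclass of those sets from which e
   computes no number >= m outside one side of R_n, for the first pair of a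
   bound m and a side such that this subclass is nonempty. Such a pair exists,
   because a member computing a cohesive set shows so. Emptiness of an
   effectively closed class is c.e., so the sides chosen are limit computable,
   and any finitely many of them have infinite intersection, as witnessed by a
   cohesive set computed from a member of the corresponding subclass. This is
   enough to build a computable cohesive set. *)
From Pilot Require Import Defs.
From mathcomp Require Import all_boot all_order all_algebra.
From mathcomp Require Import all_classical all_reals all_analysis.
From mathcomp Require Import zify.
Import Pilot.Defs.

Set Implicit Arguments.
Unset Strict Implicit.
Unset Printing Implicit Defensive.

(** * Computable functions on encodable types *)

Lemma eval_comp1 A f g xs u y :
  eval A f [:: u] y -> eval A g xs u -> eval A (Comp f [:: g]) xs y.
Proof. by move=> fy gu; exists [:: u] => //=; repeat constructor. Qed.

Lemma eval_comp2 A f g h xs u v y :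
  eval A f [:: u; v] y -> eval A g xs u -> eval A h xs v ->
  eval A (Comp f [:: g; h]) xs y.
Proof. by move=> fy gu hv; exists [:: u; v] => //=; repeat constructor. Qed.

Definition add_code := PrimRec (Proj 0) (Comp Succ [:: Proj 1]).

Lemma eval_add A m n : eval A add_code [:: m; n] (m + n).
Proof. by exists (fun i => i + n); split=> // i _; apply: eval_comp1. Qed.

Definition pred_code := PrimRec Zero (Proj 0).

Lemma eval_pred A n : eval A pred_code [:: n] n.-1.
Proof. by exists predn; split. Qed.

Definition sub_code :=
  Comp (PrimRec (Proj 0) (Comp pred_code [:: Proj 1])) [:: Proj 1; Proj 0].

Lemma eval_sub A m n : eval A sub_code [:: m; n] (m - n).
Proof.
apply: eval_comp2; [|exact: erefl|exact: erefl].
exists (fun i => m - i); split=> // [|i _]; first by rewrite subn0.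
by rewrite subnS; apply: (eval_comp1 (eval_pred _ _) _).
Qed.

Fixpoint tri n := if n is i.+1 then (i + tri i).+1 else 0.

Definition tri_code :=
  PrimRec Zero (Comp Succ [:: Comp add_code [:: Proj 0; Proj 1]]).

Lemma eval_tri A n : eval A tri_code [:: n] (tri n).
Proof.
exists tri; split=> // i _; apply: (eval_comp1 (u := i + tri i)) => //.
by apply: (eval_comp2 (eval_add _ _ _)).
Qed.

Lemma leq_tri m n : m <= n -> tri m <= tri n.
Proof. by move=> /subnK <-; elim: (n - m) => //= k IH; lia. Qed.

(* The largest [t] with [tri t <= z]; the truncated subtraction is the 0-1 test
   for increasing it. *)
Fixpoint troot z :=
  if z is z'.+1 then troot z' + (1 - (tri (troot z').+1 - z'.+1)) else 0.

Lemma troot_bounds z : tri (troot z) <= z < tri (troot z).+1.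
Proof.
elim: z => [|z /=]; first by [].
case: (ltngtP (troot z + tri (troot z)).+1 z.+1) => H.
- by lia.
- have -> : 1 - ((troot z + tri (troot z)).+1 - z.+1) = 0 by lia.
  by rewrite addn0; lia.
- by rewrite H subnn subn0 addn1 /=; lia.
Qed.

Lemma troot_unique t z : tri t <= z < tri t.+1 -> troot z = t.
Proof.
move=> /andP[t1 t2]; have /andP[u1 u2] := troot_bounds z.
apply/eqP; rewrite eqn_leq; apply/andP; split; rewrite leqNgt; apply/negP.
  by move=> /leq_tri; lia.
by move=> /leq_tri; lia.
Qed.

Definition troot_code := PrimRec Zero
  (Comp add_code [:: Proj 1; Comp sub_code
    [:: Comp Succ [:: Zero]; Comp sub_code
       [:: Comp tri_code [:: Comp Succ [:: Proj 1]]; Comp Succ [:: Proj 0]]]]).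

Lemma eval_troot A z : eval A troot_code [:: z] (troot z).
Proof.
exists troot; split=> // i _.
apply: (eval_comp2 (eval_add _ _ _)); first exact: erefl.
apply: (eval_comp2 (eval_sub _ _ _)).
  by apply: eval_comp1; exact: erefl.
apply: (eval_comp2 (eval_sub _ _ _)).
  by apply: (eval_comp1 (eval_tri _ _)); apply: eval_comp1; exact: erefl.
by apply: eval_comp1; exact: erefl.
Qed.

Definition npair x y := tri (x + y) + x.
Definition nfst z := z - tri (troot z).
Definition nsnd z := troot z - nfst z.

Lemma troot_npair x y : troot (npair x y) = x + y.
Proof. by apply: troot_unique; rewrite /npair /=; lia. Qed.

Lemma nfst_npair x y : nfst (npair x y) = x.
Proof. by rewrite /nfst troot_npair /npair; lia. Qed.

Lemma nsnd_npair x y : nsnd (npair x y) = y.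
Proof. by rewrite /nsnd nfst_npair troot_npair; lia. Qed.

Lemma npair_proj z : npair (nfst z) (nsnd z) = z.
Proof.
have /andP[/= z1 z2] := troot_bounds z.
have le_fst : nfst z <= troot z by rewrite /nfst; lia.
by rewrite /npair /nsnd subnKC // /nfst; lia.
Qed.

Lemma leq_tri_id n : n <= tri n.
Proof. by elim: n => //= n IH; lia. Qed.

Lemma leq_npairr x y : y <= npair x y.
Proof. by rewrite /npair; have := leq_tri_id (x + y); lia. Qed.

Definition npair_code :=
  Comp add_code [:: Comp tri_code [:: add_code]; Proj 0].

Lemma eval_npair A x y : eval A npair_code [:: x; y] (npair x y).
Proof.
apply: (eval_comp2 (eval_add _ _ _)); last exact: erefl.
by apply: (eval_comp1 (eval_tri _ _)); exact: eval_add.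
Qed.

Definition nfst_code :=
  Comp sub_code [:: Proj 0; Comp tri_code [:: troot_code]].

Lemma eval_nfst A z : eval A nfst_code [:: z] (nfst z).
Proof.
apply: (eval_comp2 (eval_sub _ _ _)); first exact: erefl.
by apply: (eval_comp1 (eval_tri _ _)); exact: eval_troot.
Qed.

Definition nsnd_code := Comp sub_code [:: troot_code; nfst_code].

Lemma eval_nsnd A z : eval A nsnd_code [:: z] (nsnd z).
Proof.
by apply: (eval_comp2 (eval_sub _ _ _)); [exact: eval_troot | exact: eval_nfst].
Qed.

(* Runs [ct] if [cb] yields 1. If [cb] yields 0 then [ct] is not evaluated, so
   it need not halt. *)
Definition branch cb ct ce :=
  Comp (PrimRec ce (Comp ct [:: Proj 2])) [:: cb; Proj 0].

Lemma eval_branch A cb ct ce x (b : bool) y z :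
  eval A cb [:: x] b -> (b -> eval A ct [:: x] y) -> eval A ce [:: x] z ->
  eval A (branch cb ct ce) [:: x] (if b then y else z).
Proof.
move=> eb ey ez; apply: eval_comp2; [|exact: eb|exact: erefl].
exists (fun i => if i is 0 then z else y); split=> // [i|]; last by case: (b).
by case: b eb ey => // _ ey _; apply: (eval_comp1 (ey isT)).
Qed.

Class encodable (T : Type) :=
  Encodable { enc : T -> nat; dec : nat -> T; encK : cancel enc dec }.
Arguments Encodable {T}.

Class full_encodable (T : Type) {eT : encodable T} :=
  decK : cancel (@dec T eT) (@enc T eT).
Arguments full_encodable T {eT}.

Instance nat_encodable : encodable nat := Encodable id id (fun=> erefl).

Instance nat_full : full_encodable nat := fun=> erefl.

Lemma bool_encK : cancel nat_of_bool (leq 1).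
Proof. by case. Qed.

Instance bool_encodable : encodable bool := Encodable _ _ bool_encK.

Lemma prod_encK (A B : Type) (eA : encodable A) (eB : encodable B) :
  cancel (fun p : A * B => npair (enc p.1) (enc p.2))
         (fun n => (dec (nfst n), dec (nsnd n))).
Proof. by move=> [a b] /=; rewrite nfst_npair nsnd_npair !encK. Qed.

Instance prod_encodable (A B : Type) (eA : encodable A) (eB : encodable B) :
  encodable (A * B) := Encodable _ _ (@prod_encK A B eA eB).

Instance prod_full (A B : Type) (eA : encodable A) (eB : encodable B)
  (fA : full_encodable A) (fB : full_encodable B) : full_encodable (A * B).
Proof. by move=> n; rewrite /= !decK npair_proj. Qed.

Fixpoint seq_enc (A : Type) (eA : encodable A) (s : seq A) : nat :=
  if s is x :: s' then (npair (enc x) (seq_enc eA s')).+1 else 0.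

Fixpoint seq_dec_fuel (A : Type) (eA : encodable A) k n : seq A :=
  match k, n with
  | k'.+1, n'.+1 => dec (nfst n') :: seq_dec_fuel eA k' (nsnd n')
  | _, _ => [::]
  end.

Definition seq_dec (A : Type) (eA : encodable A) n : seq A :=
  seq_dec_fuel eA n n.

Lemma seq_encK (A : Type) (eA : encodable A) :
  cancel (@seq_enc A eA) (@seq_dec A eA).
Proof.
move=> s; rewrite /seq_dec.
suff H k : seq_enc eA s <= k -> seq_dec_fuel eA k (seq_enc eA s) = s by exact: H.
elim: s k => [[] //|x s IH [//|k]] /=; rewrite ltnS => le_k.
rewrite nfst_npair nsnd_npair encK IH //; apply: leq_trans le_k.
exact: leq_npairr.
Qed.

Instance seq_encodable (A : Type) (eA : encodable A) : encodable (seq A) :=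
  Encodable _ _ (@seq_encK A eA).

Instance seq_full (A : Type) (eA : encodable A) (fA : full_encodable A) :
  full_encodable (seq A).
Proof.
move=> n; rewrite /= /seq_dec.
suff H k : n <= k -> seq_enc eA (seq_dec_fuel eA k n) = n by exact: H.
elim: k n => [[] //|k IH [//|n]] /=; rewrite ltnS => le_k.
rewrite decK IH ?npair_proj //; apply: leq_trans le_k.
by rewrite -{2}[n]npair_proj leq_npairr.
Qed.

Lemma size_leq_enc (A : Type) (eA : encodable A) (s : seq A) : size s <= enc s.
Proof.
by elim: s => //= x s IH; rewrite ltnS (leq_trans IH) // leq_npairr.
Qed.

Definition effective (A B : Type) {eA : encodable A} {eB : encodable B}
    (f : A -> B) : Prop :=
  exists c, forall a, eval empty_oracle c [:: enc a] (enc (f a)).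

Lemma effective_id (A : Type) (eA : encodable A) : effective (fun a : A => a).
Proof. by exists (Proj 0). Qed.

Lemma effective_const (A B : Type) (eA : encodable A) (eB : encodable B) (b : B) :
  effective (fun _ : A => b).
Proof.
exists (iter (enc b) (fun c => Comp Succ [:: c]) Zero) => a.
by elim: (enc b) => // n IH; apply: (eval_comp1 _ IH).
Qed.

Lemma effective_comp (A B C : Type) (eA : encodable A) (eB : encodable B)
    (eC : encodable C) (g : B -> C) (f : A -> B) :
  effective g -> effective f -> effective (fun a => g (f a)).
Proof.
by move=> [cg Hg] [cf Hf]; exists (Comp cg [:: cf]) => a; apply: eval_comp1.
Qed.

Lemma effective_pair (A B C : Type) (eA : encodable A) (eB : encodable B)
    (eC : encodable C) (f : A -> B) (g : A -> C) :
  effective f -> effective g -> effective (fun a => (f a, g a)).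
Proof.
move=> [cf Hf] [cg Hg]; exists (Comp npair_code [:: cf; cg]) => a.
by apply: (eval_comp2 (eval_npair _ _ _)).
Qed.

Lemma effective_comp2 (A B C D : Type) (eA : encodable A) (eB : encodable B)
    (eC : encodable C) (eD : encodable D) (h : B -> C -> D) (f : A -> B)
    (g : A -> C) :
  effective (fun p => h p.1 p.2) -> effective f -> effective g ->
  effective (fun a => h (f a) (g a)).
Proof.
move=> eh ef eg; apply: (effective_comp (f := fun a => (f a, g a)) eh).
exact: effective_pair.
Qed.

Lemma effective_fst (A B C : Type) (eA : encodable A) (eB : encodable B)
    (eC : encodable C) (f : A -> B * C) :
  effective f -> effective (fun a => (f a).1).
Proof.
move=> [c H]; exists (Comp nfst_code [:: c]) => a.
apply: (eval_comp1 _ (H a)).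
by rewrite -[X in eval _ _ _ X](nfst_npair _ (enc (f a).2)); apply: eval_nfst.
Qed.

Lemma effective_snd (A B C : Type) (eA : encodable A) (eB : encodable B)
    (eC : encodable C) (f : A -> B * C) :
  effective f -> effective (fun a => (f a).2).
Proof.
move=> [c H]; exists (Comp nsnd_code [:: c]) => a.
apply: (eval_comp1 _ (H a)).
by rewrite -[X in eval _ _ _ X](nsnd_npair (enc (f a).1)); apply: eval_nsnd.
Qed.

Lemma effective_nfst (A : Type) (eA : encodable A) (f : A -> nat) :
  effective f -> effective (fun a => nfst (f a)).
Proof.
move=> [c H]; exists (Comp nfst_code [:: c]) => a.
by apply: (eval_comp1 (eval_nfst _ _)).
Qed.

Lemma effective_nsnd (A : Type) (eA : encodable A) (f : A -> nat) :
  effective f -> effective (fun a => nsnd (f a)).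
Proof.
move=> [c H]; exists (Comp nsnd_code [:: c]) => a.
by apply: (eval_comp1 (eval_nsnd _ _)).
Qed.

Lemma effective_enc (A B : Type) (eA : encodable A) (eB : encodable B)
    (f : A -> B) :
  effective f -> effective (fun a => enc (f a)).
Proof. by []. Qed.

Lemma effective_dec (A B : Type) (eA : encodable A) (eB : encodable B)
    (fB : full_encodable B) (f : A -> nat) :
  effective f -> effective (fun a => dec (f a) : B).
Proof. by move=> [c H]; exists c => a; rewrite decK. Qed.

Lemma effective_succn (A : Type) (eA : encodable A) (f : A -> nat) :
  effective f -> effective (fun a => (f a).+1).
Proof.
by move=> [c H]; exists (Comp Succ [:: c]) => a; apply: (eval_comp1 _ (H a)).
Qed.

Lemma effective_predn (A : Type) (eA : encodable A) (f : A -> nat) :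
  effective f -> effective (fun a => (f a).-1).
Proof.
move=> [c H]; exists (Comp pred_code [:: c]) => a.
by apply: (eval_comp1 (eval_pred _ _) (H a)).
Qed.

Lemma effective_addn (A : Type) (eA : encodable A) (f g : A -> nat) :
  effective f -> effective g -> effective (fun a => f a + g a).
Proof.
move=> [c H] [d G]; exists (Comp add_code [:: c; d]) => a.
by apply: (eval_comp2 (eval_add _ _ _) (H a) (G a)).
Qed.

Lemma effective_subn (A : Type) (eA : encodable A) (f g : A -> nat) :
  effective f -> effective g -> effective (fun a => f a - g a).
Proof.
move=> [c H] [d G]; exists (Comp sub_code [:: c; d]) => a.
by apply: (eval_comp2 (eval_sub _ _ _) (H a) (G a)).
Qed.

Lemma effective_if (A B : Type) (eA : encodable A) (eB : encodable B)
    (b : A -> bool) (f g : A -> B) :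
  effective b -> effective f -> effective g ->
  effective (fun a => if b a then f a else g a).
Proof.
move=> [cb Hb] [cf Hf] [cg Hg]; exists (branch cb cf cg) => a.
have -> : enc (if b a then f a else g a) = if b a then enc (f a) else enc (g a).
  by case: (b a).
exact: eval_branch.
Qed.

Lemma effective_iteri (A B : Type) (eA : encodable A) (eB : encodable B)
    (n : A -> nat) (g : A -> nat -> B -> B) (f : A -> B) :
  effective (fun p : A * (nat * B) => g p.1 p.2.1 p.2.2) -> effective n ->
  effective f -> effective (fun a => iteri (n a) (g a) (f a)).
Proof.
move=> [cg Hg] [cn Hn] [cf Hf].
pose cg' := Comp cg [:: Comp npair_code
  [:: Proj 2; Comp npair_code [:: Proj 0; Proj 1]]].
exists (Comp (PrimRec cf cg') [:: cn; Proj 0]) => a.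
apply: eval_comp2; [|exact: Hn|exact: erefl].
exists (fun i => enc (iteri i (g a) (f a))); split=> [|i _|//]; first exact: Hf.
apply: (eval_comp1 (Hg (a, (i, iteri i (g a) (f a))))).
apply: (eval_comp2 (eval_npair _ _ _)); first exact: erefl.
by apply: (eval_comp2 (eval_npair _ _ _)); exact: erefl.
Qed.

Lemma effective_search (A : Type) (eA : encodable A) (p : A -> nat -> bool)
    (f : A -> nat) :
  effective (fun q => p q.1 q.2) -> (forall a, p a (f a)) ->
  (forall a m, p a m -> f a <= m) -> effective f.
Proof.
move=> ep pf fmin.
have [c Hc] : effective (fun q => if p q.1 q.2 then false else true).
  by apply: effective_if => //; apply: effective_const.
exists (Mu (Comp c [:: Comp npair_code [:: Proj 1; Proj 0]])) => a.
have E m : eval empty_oracle (Comp c [:: Comp npair_code [:: Proj 1; Proj 0]])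
                [:: m; enc a] (if p a m then false else true).
  apply: (eval_comp1 (Hc (a, m))).
  by apply: (eval_comp2 (eval_npair _ _ _)); exact: erefl.
split=> [|m lt_m]; first by have := E (f a); rewrite pf.
exists 0; have := E m; case: (boolP (p a m)) => // /fmin.
by rewrite leqNgt lt_m.
Qed.

Lemma effective_cons (A B : Type) (eA : encodable A) (eB : encodable B)
    (f : A -> B) (g : A -> seq B) :
  effective f -> effective g -> effective (fun a => f a :: g a).
Proof.
move=> ef eg; have [c H] := effective_pair ef eg.
by exists (Comp Succ [:: c]) => a; apply: (eval_comp1 _ (H a)).
Qed.

Lemma effective_case (A B C : Type) (eA : encodable A) (eB : encodable B)
    (eC : encodable C) (l : A -> seq B) (f : A -> C) (g : A -> B -> seq B -> C) :
  effective (fun p : A * (B * seq B) => g p.1 p.2.1 p.2.2) -> effective l ->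
  effective f -> effective (fun a => if l a is x :: s then g a x s else f a).
Proof.
move=> [cg Hg] el [cf Hf].
have ez : effective (fun a => 1 - (1 - enc (l a))).
  apply: effective_subn; first exact: effective_const.
  by apply: effective_subn; first exact: effective_const.
have [cz Hz] := ez; have [cp Hp] := effective_predn (effective_enc el).
exists (branch cz (Comp cg [:: Comp npair_code [:: Proj 0; cp]]) cf) => a.
have := Hz a; have := Hp a; case: (l a) => [|x s] ep eb.
  exact: (@eval_branch _ _ _ _ _ false 0 (enc (f a))).
apply: (@eval_branch _ _ _ _ _ true _ (enc (f a))) => // _.
apply: (eval_comp1 (Hg (a, (x, s)))).
by apply: (eval_comp2 (eval_npair _ _ _)).
Qed.

Lemma effective_iter (A B : Type) (eA : encodable A) (eB : encodable B)
    (n : A -> nat) (g : A -> B -> B) (f : A -> B) :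
  effective (fun p : A * B => g p.1 p.2) -> effective n ->
  effective f -> effective (fun a => iter (n a) (g a) (f a)).
Proof.
move=> eg en ef.
rewrite (_ : (fun _ => _) = fun a => iteri (n a) (fun=> g a) (f a)).
  apply: (effective_iteri (g := fun a _ => g a)) => //.
  apply: (effective_comp2 (f := fun p => p.1) (g := fun p => p.2.2)) => //.
    by apply: effective_fst; apply: effective_id.
  by do 2!apply: effective_snd; apply: effective_id.
by apply/funext => a; elim: (n a) => //= k ->.
Qed.

Lemma effective_foldl (A B C : Type) (eA : encodable A) (eB : encodable B)
    (eC : encodable C) (g : A -> C -> B -> C) (f : A -> C) (l : A -> seq B) :
  effective (fun p : A * (C * B) => g p.1 p.2.1 p.2.2) -> effective f ->
  effective l -> effective (fun a => foldl (g a) (f a) (l a)).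
Proof.
move=> eg ef el.
pose step a (st : C * seq B) :=
  if st.2 is x :: s then (g a st.1 x, s) else st.
have stepE k a c s : size s <= k ->
    iter k (step a) (c, s) = (foldl (g a) c s, [::]).
  elim: k c s => [|k IH] c [|x s] //.
    by move=> _; rewrite iterSr /step /= IH.
  by move=> le_k; rewrite iterSr {2}/step /= IH.
rewrite (_ : (fun _ => _) =
  fun a => (iter (enc (l a)) (step a) (f a, l a)).1); last first.
  by apply/funext => a; rewrite stepE // size_leq_enc.
apply: effective_fst; apply: effective_iter => //.
  rewrite /step; apply: (effective_case (l := fun p => p.2.2) (f := fun p => p.2)
    (g := fun p x s => (g p.1 p.2.1 x, s))).
  - apply: effective_pair.
      apply: (effective_comp (f := fun p => (p.1.1, (p.1.2.1, p.2.1))) eg).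
      apply: effective_pair.
        by do 2!apply: effective_fst; apply: effective_id.
      apply: effective_pair; apply: effective_fst.
        by apply: effective_snd; apply: effective_fst; apply: effective_id.
      by apply: effective_snd; apply: effective_id.
    by do 2!apply: effective_snd; apply: effective_id.
  - by do 2!apply: effective_snd; apply: effective_id.
  - by apply: effective_snd; apply: effective_id.
exact: effective_pair.
Qed.

Lemma effective_nat_of_bool (A : Type) (eA : encodable A) (f : A -> bool) :
  effective f -> effective (fun a => nat_of_bool (f a)).
Proof. by []. Qed.

Lemma effective_eq0 (A : Type) (eA : encodable A) (f : A -> nat) :
  effective f -> effective (fun a => f a == 0).
Proof.
move=> ef; have [c H] := effective_subn (effective_const eA _ 1) ef.
by exists c => a; have := H a; case: (f a).
Qed.

Lemma effective_leq (A : Type) (eA : encodable A) (f g : A -> nat) :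
  effective f -> effective g -> effective (fun a => f a <= g a).
Proof. by move=> ef eg; apply: effective_eq0; apply: effective_subn. Qed.

Lemma effective_eq (A : Type) (B : eqType) (eA : encodable A) (eB : encodable B)
    (f g : A -> B) :
  effective f -> effective g -> effective (fun a => f a == g a).
Proof.
move=> ef eg; rewrite (_ : (fun _ => _) =
    fun a => (enc (f a) - enc (g a)) + (enc (g a) - enc (f a)) == 0).
  by apply: effective_eq0; apply: effective_addn; apply: effective_subn.
apply/funext => a; rewrite -(inj_eq (can_inj (encK (encodable := eB)))).
by rewrite addn_eq0 !subn_eq0 eqn_leq.
Qed.

Lemma effective_andb (A : Type) (eA : encodable A) (f g : A -> bool) :
  effective f -> effective g -> effective (fun a => f a && g a).
Proof. by move=> ef eg; apply: (effective_if ef eg (effective_const _ _ _)). Qed.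

Lemma effective_orb (A : Type) (eA : encodable A) (f g : A -> bool) :
  effective f -> effective g -> effective (fun a => f a || g a).
Proof. by move=> ef eg; apply: (effective_if ef (effective_const _ _ _) eg). Qed.

Lemma effective_implb (A : Type) (eA : encodable A) (f g : A -> bool) :
  effective f -> effective g -> effective (fun a => f a ==> g a).
Proof. by move=> ef eg; apply: (effective_if ef eg (effective_const _ _ _)). Qed.

Lemma effective_negb (A : Type) (eA : encodable A) (f : A -> bool) :
  effective f -> effective (fun a => ~~ f a).
Proof.
move=> ef.
exact: (effective_if ef (effective_const _ _ _) (effective_const _ _ _)).
Qed.

Lemma effective_double (A : Type) (eA : encodable A) (f : A -> nat) :
  effective f -> effective (fun a => (f a).*2).
Proof.
move=> ef; rewrite (_ : (fun _ => _) = fun a => f a + f a).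
  exact: effective_addn.
by apply/funext => a; rewrite addnn.
Qed.

Ltac effective_base_step :=
  match goal with
  | H : effective ?f |- effective ?f => exact: H
  | _ => exact: effective_id
  | _ => exact: effective_const
  | |- effective (fun a => (_, _)) => apply: effective_pair
  | |- effective (fun a => fst _) => apply: effective_fst
  | |- effective (fun a => snd _) => apply: effective_snd
  | |- effective (fun a => enc _) => apply: effective_enc
  | |- effective (fun a => dec _) => apply: effective_dec
  | |- effective (fun a => nfst _) => apply: effective_nfst
  | |- effective (fun a => nsnd _) => apply: effective_nsnd
  | |- effective (fun a => S _) => apply: effective_succn
  | |- effective (fun a => predn _) => apply: effective_predn
  | |- effective (fun a => addn _ _) => apply: effective_addn
  | |- effective (fun a => subn _ _) => apply: effective_subn
  | |- effective (fun a => double _) => apply: effective_double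
  | |- effective (fun a => nat_of_bool _) => apply: effective_nat_of_bool
  | |- effective (fun a => leq _ _) => apply: effective_leq
  | |- effective (fun a => _ == _) => apply: effective_eq
  | |- effective (fun a => _ && _) => apply: effective_andb
  | |- effective (fun a => _ || _) => apply: effective_orb
  | |- effective (fun a => _ ==> _) => apply: effective_implb
  | |- effective (fun a => ~~ _) => apply: effective_negb
  | |- effective (fun a => if _ then _ else _) => apply: effective_if
  | |- effective (fun a => iter _ _ _) => apply: effective_iter
  | |- effective (fun a => iteri _ _ _) => apply: effective_iteri
  | |- effective (fun a => _ :: _) => apply: effective_cons
  | |- effective (fun a => foldl _ _ _) => apply: effective_foldl
  | |- effective (fun a => if _ is _ :: _ then _ else _) => apply: effective_case
  | |- effective ?f =>
      lazymatch f with
      | (fun a => _) => fail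
      | _ => change (effective (fun a => f a))
      end
  end.

Ltac effective_step := effective_base_step.

Ltac effectivity := repeat (effective_step; cbv beta).

Lemma effective_rev (A B : Type) (eA : encodable A) (eB : encodable B)
    (f : A -> seq B) :
  effective f -> effective (fun a => rev (f a)).
Proof.
move=> ef; rewrite (_ : (fun _ => _) =
    fun a => foldl (fun s x => x :: s) [::] (f a)).
  by effectivity.
apply/funext => a; rewrite /rev; move: [::].
by elim: (f a) => //= x s IH t; rewrite IH.
Qed.

Lemma effective_foldr (A B C : Type) (eA : encodable A) (eB : encodable B)
    (eC : encodable C) (g : A -> B -> C -> C) (f : A -> C) (l : A -> seq B) :
  effective (fun p : A * (B * C) => g p.1 p.2.1 p.2.2) -> effective f ->
  effective l -> effective (fun a => foldr (g a) (f a) (l a)).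
Proof.
move=> eg ef el; rewrite (_ : (fun _ => _) =
    fun a => foldl (fun z x => g a x z) (f a) (rev (l a))); last first.
  by apply/funext => a; rewrite foldl_rev.
apply: effective_foldl => //=; last exact: effective_rev.
by apply: (effective_comp (f := fun p => (p.1, (p.2.2, p.2.1))) eg); effectivity.
Qed.

Lemma effective_foldr_map (A B C D : Type) (eA : encodable A) (eB : encodable B)
    (eC : encodable C) (eD : encodable D) (k : D -> C -> C) (g : A -> B -> D)
    (z : C) (l : A -> seq B) :
  effective (fun p => k p.1 p.2) -> effective (fun p => g p.1 p.2) ->
  effective l -> effective (fun a => foldr (fun x => k (g a x)) z (l a)).
Proof.
move=> ek eg el; apply: effective_foldr => //; last exact: effective_const.
apply: (effective_comp2 (f := fun p => g p.1 p.2.1) (g := fun p => p.2.2)) => //.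
  by apply: (effective_comp (f := fun p => (p.1, p.2.1)) eg); effectivity.
by effectivity.
Qed.

Lemma effective_map (A B C : Type) (eA : encodable A) (eB : encodable B)
    (eC : encodable C) (g : A -> B -> C) (l : A -> seq B) :
  effective (fun p => g p.1 p.2) -> effective l ->
  effective (fun a => map (g a) (l a)).
Proof.
by move=> eg el; apply: (effective_foldr_map (k := cons)) => //; effectivity.
Qed.

Lemma effective_has (A B : Type) (eA : encodable A) (eB : encodable B)
    (p : A -> B -> bool) (l : A -> seq B) :
  effective (fun q => p q.1 q.2) -> effective l ->
  effective (fun a => has (p a) (l a)).
Proof.
by move=> eg el; apply: (effective_foldr_map (k := orb)) => //; effectivity.
Qed.

Lemma effective_all (A B : Type) (eA : encodable A) (eB : encodable B)
    (p : A -> B -> bool) (l : A -> seq B) :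
  effective (fun q => p q.1 q.2) -> effective l ->
  effective (fun a => all (p a) (l a)).
Proof.
by move=> eg el; apply: (effective_foldr_map (k := andb)) => //; effectivity.
Qed.

Lemma effective_count (A B : Type) (eA : encodable A) (eB : encodable B)
    (p : A -> B -> bool) (l : A -> seq B) :
  effective (fun q => p q.1 q.2) -> effective l ->
  effective (fun a => count (p a) (l a)).
Proof.
move=> eg el.
apply: (effective_foldr_map (k := fun b n => nat_of_bool b + n)) => //.
by effectivity.
Qed.

Lemma effective_find (A B : Type) (eA : encodable A) (eB : encodable B)
    (p : A -> B -> bool) (l : A -> seq B) :
  effective (fun q => p q.1 q.2) -> effective l ->
  effective (fun a => find (p a) (l a)).
Proof.
move=> eg el.
apply: (effective_foldr_map (k := fun b n => if b then 0 else n.+1)) => //.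
by effectivity.
Qed.

Lemma effective_size (A B : Type) (eA : encodable A) (eB : encodable B)
    (l : A -> seq B) :
  effective l -> effective (fun a => size (l a)).
Proof.
by move=> el; apply: (effective_foldr (g := fun _ _ n => n.+1)) => //; effectivity.
Qed.

Lemma effective_cat (A B : Type) (eA : encodable A) (eB : encodable B)
    (f g : A -> seq B) :
  effective f -> effective g -> effective (fun a => f a ++ g a).
Proof.
move=> ef eg; rewrite (_ : (fun _ => _) = fun a => foldr cons (g a) (f a)).
  by apply: (effective_foldr (g := fun=> cons)) => //; effectivity.
by apply/funext => a; elim: (f a) => //= x s ->.
Qed.

Lemma effective_rcons (A B : Type) (eA : encodable A) (eB : encodable B)
    (f : A -> seq B) (g : A -> B) :
  effective f -> effective g -> effective (fun a => rcons (f a) (g a)).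
Proof.
move=> ef eg; rewrite (_ : (fun _ => _) = fun a => f a ++ [:: g a]).
  by apply: effective_cat => //; effectivity.
by apply/funext => a; rewrite cats1.
Qed.

Lemma effective_behead (A B : Type) (eA : encodable A) (eB : encodable B)
    (f : A -> seq B) :
  effective f -> effective (fun a => behead (f a)).
Proof.
by move=> ef; apply: (effective_case (g := fun _ _ s => s)) => //; effectivity.
Qed.

Lemma effective_drop (A B : Type) (eA : encodable A) (eB : encodable B)
    (n : A -> nat) (f : A -> seq B) :
  effective n -> effective f -> effective (fun a => drop (n a) (f a)).
Proof.
move=> en ef; rewrite (_ : (fun _ => _) = fun a => iter (n a) behead (f a)).
  apply: (effective_iter (g := fun _ => behead)) => //.
  by apply: effective_behead; effectivity.
apply/funext => a; elim: (n a) (f a) => [|k IH] s; first by rewrite drop0.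
by rewrite iterSr -IH; case: s.
Qed.

Lemma effective_take (A B : Type) (eA : encodable A) (eB : encodable B)
    (n : A -> nat) (f : A -> seq B) :
  effective n -> effective f -> effective (fun a => take (n a) (f a)).
Proof.
move=> en ef; rewrite (_ : (fun _ => _) =
    fun a => rev (drop (size (f a) - n a) (rev (f a)))).
  apply: effective_rev; apply: effective_drop; last exact: effective_rev.
  by apply: effective_subn => //; apply: effective_size.
apply/funext => a; rewrite drop_rev revK; case: (leqP (n a) (size (f a))) => H.
  by rewrite subKn.
have -> : size (f a) - n a = 0 by lia.
by rewrite subn0 take_size take_oversize // ltnW.
Qed.

Lemma effective_nth (A B : Type) (eA : encodable A) (eB : encodable B) (x : B)
    (f : A -> seq B) (n : A -> nat) :
  effective f -> effective n -> effective (fun a => nth x (f a) (n a)).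
Proof.
move=> ef en; rewrite (_ : (fun _ => _) = fun a => head x (drop (n a) (f a))).
  apply: (effective_case (g := fun _ y _ => y)); first by effectivity.
    exact: effective_drop.
  exact: effective_const.
by apply/funext => a; rewrite -nth0 nth_drop addn0.
Qed.

Lemma effective_iota (A : Type) (eA : encodable A) (m n : A -> nat) :
  effective m -> effective n -> effective (fun a => iota (m a) (n a)).
Proof.
move=> em en; rewrite (_ : (fun _ => _) =
    fun a => iteri (n a) (fun i s => rcons s (m a + i)) [::]).
  apply: effective_iteri => //; last exact: effective_const.
  apply: effective_rcons; first by effectivity.
  apply: effective_addn; last by effectivity.
  by apply: (effective_comp em); effectivity.
apply/funext => a; elim: (n a) => // k IH.
by rewrite -{1}[k.+1]addn1 iotaD cats1 IH.
Qed.

Lemma effective_mem (A : Type) (B : eqType) (eA : encodable A)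
    (eB : encodable B) (f : A -> B) (l : A -> seq B) :
  effective f -> effective l -> effective (fun a => f a \in l a).
Proof.
move=> ef el; rewrite (_ : (fun _ => _) = fun a => has (fun y => y == f a) (l a)).
  apply: effective_has => //; apply: effective_eq; first by effectivity.
  by apply: (effective_comp ef); effectivity.
by apply/funext => a; rewrite -has_pred1.
Qed.

Lemma effective_muln (A : Type) (eA : encodable A) (f g : A -> nat) :
  effective f -> effective g -> effective (fun a => f a * g a).
Proof.
move=> ef eg; rewrite (_ : (fun _ => _) = fun a => iter (f a) (addn (g a)) 0).
  apply: effective_iter => //; last exact: effective_const.
  apply: effective_addn; last by effectivity.
  by apply: (effective_comp eg); effectivity.
by apply/funext => a; rewrite iter_addn addn0 mulnC.
Qed.

Lemma effective_expn (A : Type) (eA : encodable A) (f g : A -> nat) :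
  effective f -> effective g -> effective (fun a => f a ^ g a).
Proof.
move=> ef eg; rewrite (_ : (fun _ => _) = fun a => iter (g a) (muln (f a)) 1).
  apply: effective_iter => //; last exact: effective_const.
  apply: effective_muln; last by effectivity.
  by apply: (effective_comp ef); effectivity.
by apply/funext => a; rewrite iter_muln muln1.
Qed.

Ltac effective_step ::=
  first [ effective_base_step
  | match goal with
    | |- effective (fun a => muln _ _) => apply: effective_muln
    | |- effective (fun a => expn _ _) => apply: effective_expn
    | |- effective (fun a => foldr _ _ _) => apply: effective_foldr
    | |- effective (fun a => map _ _) => apply: effective_map
    | |- effective (fun a => has _ _) => apply: effective_has
    | |- effective (fun a => all _ _) => apply: effective_all
    | |- effective (fun a => count _ _) => apply: effective_count
    | |- effective (fun a => find _ _) => apply: effective_find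
    | |- effective (fun a => size _) => apply: effective_size
    | |- effective (fun a => _ ++ _) => apply: effective_cat
    | |- effective (fun a => rcons _ _) => apply: effective_rcons
    | |- effective (fun a => behead _) => apply: effective_behead
    | |- effective (fun a => take _ _) => apply: effective_take
    | |- effective (fun a => nth _ _ _) => apply: effective_nth
    | |- effective (fun a => iota _ _) => apply: effective_iota
    | |- effective (fun a => _ \in _) => apply: effective_mem
    end ].

(** * Derivations of computations *)

Fixpoint code_nested_ind (P : code -> Prop) (HZ : P Zero) (HS : P Succ)
    (HP : forall i, P (Proj i)) (HO : P Oracle)
    (HC : forall f gs, P f -> (forall i, i < size gs -> P (nth Zero gs i)) ->
      P (Comp f gs))
    (HR : forall f g, P f -> P g -> P (PrimRec f g))
    (HM : forall f, P f -> P (Mu f)) (c : code) : P c.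
Proof.
pose IH := code_nested_ind P HZ HS HP HO HC HR HM.
refine (match c with
  | Zero => HZ | Succ => HS | Proj i => HP i | Oracle => HO
  | Comp f gs => HC f gs (IH f) _
  | PrimRec f g => HR f g (IH f) (IH g) | Mu f => HM f (IH f)
  end).
elim: gs => [|g gs IHgs] [|i] lti.
- exact: (False_ind _ (notF lti)).
- exact: (False_ind _ (notF lti)).
- exact: (IH g).
- exact: (IHgs i lti).
Qed.

Lemma eval_CompP A f gs xs y :
  eval A (Comp f gs) xs y <->
  exists ys, [/\ size ys = size gs,
    forall i, i < size gs -> eval A (nth Zero gs i) xs (nth 0 ys i)
    & eval A f ys y].
Proof.
have H ys : List.Forall2 (fun (P : nat -> Prop) v => P v)
      [seq eval A g xs | g <- gs] ys <->
    size ys = size gs /\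
    forall i, i < size gs -> eval A (nth Zero gs i) xs (nth 0 ys i).
  elim: gs ys => [|g gs IH] ys /=.
    by split=> [H|[/size0nil -> _]]; [inversion H | constructor].
  split=> [H|].
    inversion H as [|? v ? vs gv Hvs]; subst; case/IH: Hvs => sz Hi.
    by split=> [|[|i]] //=; [rewrite sz | exact: Hi].
  case: ys => [|v vs] [] //= [sz] Hi; constructor; first exact: (Hi 0).
  by apply/IH; split=> // i; apply: (Hi i.+1).
split=> [[ys /H[? ?] ?]|[ys [? ? ?]]]; exists ys => //.
by apply/H.
Qed.

Lemma eval_functional A c xs y z : eval A c xs y -> eval A c xs z -> y = z.
Proof.
elim/code_nested_ind: c xs y z => [||i||f gs IHf IHgs|f g IHf IHg|f IHf] xs y z.
- by move=> /= -> ->.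
- by move=> /= -> ->.
- by move=> /= -> ->.
- by move=> /= -> ->.
- move=> /eval_CompP[ys [sys gys fy]] /eval_CompP[zs [szs gzs fz]].
  suff E : ys = zs by rewrite E in fy; exact: IHf fy fz.
  apply: (@eq_from_nth _ 0); first by rewrite sys.
  by move=> i; rewrite sys => lti; apply: IHgs (gys i lti) (gzs i lti).
- move=> [v [v0 vS ->]] [w [w0 wS ->]].
  suff H i : i <= nth 0 xs 0 -> v i = w i by exact: H.
  elim: i => [|i IH] lti; first exact: IHf v0 w0.
  by have := vS i lti; rewrite IH ?(ltnW lti) // => vi; apply: IHg vi (wS i lti).
- move=> [fy my] [fz mz]; case: (ltngtP y z) => // [/mz|/my] [v fv].
    by have := IHf _ _ _ fy fv.
  by have := IHf _ _ _ fz fv.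
Qed.

Fixpoint code_index (c : code) : nat :=
  match c with
  | Zero => enc (0, 0)
  | Succ => enc (1, 0)
  | Proj i => enc (2, i)
  | Oracle => enc (3, 0)
  | Comp f gs => enc (4, enc (code_index f, [seq code_index g | g <- gs]))
  | PrimRec f g => enc (5, enc (code_index f, code_index g))
  | Mu f => enc (6, code_index f)
  end.

(* [(e, (xs, y))] asserts that the program of index [e] maps [xs] to [y]. *)
Notation judgment := (nat * (seq nat * nat))%type.

Definition justified_comp (D : seq judgment) (p : nat * seq nat) xs y :=
  has (fun i : judgment =>
    [&& i.1 == p.1, i.2.2 == y, size i.2.1 == size p.2 &
     all (fun k => (nth 0 p.2 k, (xs, nth 0 i.2.1 k)) \in D) (iota 0 (size p.2))])
    D.

Definition justified_primrec (D : seq judgment) e (p : nat * nat) xs y :=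
  if nth 0 xs 0 == 0 then (p.1, (behead xs, y)) \in D
  else has (fun i : judgment =>
    [&& i.1 == e, i.2.1 == (nth 0 xs 0).-1 :: behead xs &
     (p.2, ((nth 0 xs 0).-1 :: i.2.2 :: behead xs, y)) \in D]) D.

Definition justified_mu (D : seq judgment) p xs y :=
  ((p, (y :: xs, 0)) \in D) &&
  all (fun z => has (fun i : judgment =>
    [&& i.1 == p, i.2.1 == z :: xs & 0 < i.2.2]) D) (iota 0 y).

(* [justified s D j]: one evaluation step derives [j] from judgments of [D],
   the oracle being known only on the initial segment [s]. *)
Definition justified (s : seq bool) (D : seq judgment) (j : judgment) : bool :=
  let: (e, (xs, y)) := j in
  let: (tag, p) := dec e : nat * nat in
  if tag == 0 then y == 0
  else if tag == 1 then y == (nth 0 xs 0).+1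
  else if tag == 2 then y == nth 0 xs p
  else if tag == 3 then
    (nth 0 xs 0 < size s) && (y == nth false s (nth 0 xs 0))
  else if tag == 4 then justified_comp D (dec p) xs y
  else if tag == 5 then justified_primrec D e (dec p) xs y
  else (tag == 6) && justified_mu D p xs y.

Lemma justified_code s D c xs y :
  justified s D (code_index c, (xs, y)) =
  match c with
  | Zero => y == 0
  | Succ => y == (nth 0 xs 0).+1
  | Proj i => y == nth 0 xs i
  | Oracle => (nth 0 xs 0 < size s) && (y == nth false s (nth 0 xs 0))
  | Comp f gs =>
      justified_comp D (code_index f, [seq code_index g | g <- gs]) xs y
  | PrimRec f g =>
      justified_primrec D (code_index c) (code_index f, code_index g) xs y
  | Mu f => justified_mu D (code_index f) xs y
  end.
Proof.
have E (tag p : nat) : justified s D (enc (tag, p), (xs, y)) =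
    if tag == 0 then y == 0
    else if tag == 1 then y == (nth 0 xs 0).+1
    else if tag == 2 then y == nth 0 xs p
    else if tag == 3 then
      (nth 0 xs 0 < size s) && (y == nth false s (nth 0 xs 0))
    else if tag == 4 then justified_comp D (dec p) xs y
    else if tag == 5 then justified_primrec D (enc (tag, p)) (dec p) xs y
    else (tag == 6) && justified_mu D p xs y.
  by rewrite /justified encK.
case: c => [||i||f gs|f g|f].
- by rewrite (E 0 0).
- by rewrite (E 1 0).
- by rewrite (E 2 i).
- by rewrite (E 3 0).
- by rewrite (E 4 (enc (code_index f, [seq code_index g | g <- gs]))) encK.
- by rewrite (E 5 (enc (code_index f, code_index g))) encK.
- by rewrite (E 6 (code_index f)).
Qed.

Definition derivation (s : seq bool) (D : seq judgment) := all (justified s D) D.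

Lemma effective_derivation :
  effective (fun q : seq bool * seq judgment => derivation q.1 q.2).
Proof.
rewrite /derivation; apply: effective_all; last by effectivity.
rewrite (_ : (fun _ => _) = fun q : (seq bool * seq judgment) * judgment =>
  if (dec q.2.1 : nat * nat).1 == 0 then q.2.2.2 == 0
  else if (dec q.2.1 : nat * nat).1 == 1 then q.2.2.2 == (nth 0 q.2.2.1 0).+1
  else if (dec q.2.1 : nat * nat).1 == 2 then
    q.2.2.2 == nth 0 q.2.2.1 (dec q.2.1 : nat * nat).2
  else if (dec q.2.1 : nat * nat).1 == 3 then
    (nth 0 q.2.2.1 0 < size q.1.1) && (q.2.2.2 == nth false q.1.1 (nth 0 q.2.2.1 0))
  else if (dec q.2.1 : nat * nat).1 == 4 then
    justified_comp q.1.2 (dec (dec q.2.1 : nat * nat).2) q.2.2.1 q.2.2.2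
  else if (dec q.2.1 : nat * nat).1 == 5 then
    justified_primrec q.1.2 q.2.1 (dec (dec q.2.1 : nat * nat).2) q.2.2.1 q.2.2.2
  else ((dec q.2.1 : nat * nat).1 == 6) &&
    justified_mu q.1.2 (dec q.2.1 : nat * nat).2 q.2.2.1 q.2.2.2).
  rewrite /justified_comp /justified_primrec /justified_mu.
  by effectivity.
by apply/funext => -[[s D] [e [xs y]]].
Qed.

Lemma eval_PrimRecS A f g i xs w y :
  eval A (PrimRec f g) (i :: xs) w -> eval A g [:: i, w & xs] y ->
  eval A (PrimRec f g) (i.+1 :: xs) y.
Proof.
move=> [v [v0 vS ->]] gy.
exists (fun k => if k <= i then v k else y); split=> //=; last by rewrite ltnn.
move=> k; rewrite ltnS => le_k; rewrite le_k.
case: (ltnP k i) => [lt_k|ge_k]; first exact: vS.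
by have -> : k = i by apply/eqP; rewrite eqn_leq le_k.
Qed.

Lemma derivation_sound A s D :
  (forall i, i < size s -> nth false s i = A i) -> derivation s D ->
  forall c xs y, (code_index c, (xs, y)) \in D -> eval A c xs y.
Proof.
move=> sA /allP DP c.
elim/code_nested_ind: c => [||i||f gs IHf IHgs|f g IHf IHg|f IHf] xs y yD.
- by have := DP _ yD; rewrite justified_code => /eqP.
- by have := DP _ yD; rewrite justified_code => /eqP.
- by have := DP _ yD; rewrite justified_code => /eqP.
- have := DP _ yD; rewrite justified_code => /andP[lt_s /eqP ->].
  by rewrite sA.
- have := DP _ yD; rewrite justified_code.
  rewrite /justified_comp /= => /hasP[[e [ys z]] jD] /=.
  rewrite size_map => /and4P[/eqP ee /eqP ez /eqP sys /allP Hi]; subst.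
  apply/eval_CompP; exists ys; split=> // [i lti|]; last exact: IHf.
  apply: IHgs => //; rewrite -(nth_map _ 0) //.
  by apply: Hi; rewrite mem_iota.
- set e := code_index _ in yD.
  have H i zs z : (e, (zs, z)) \in D -> nth 0 zs 0 = i ->
      eval A (PrimRec f g) (i :: behead zs) z.
    elim: i zs z => [|i IH] zs z zD zi.
      have := DP _ zD; rewrite justified_code.
      rewrite /justified_primrec zi /= => /IHf fz.
      by exists (fun=> z); split.
    have := DP _ zD; rewrite justified_code.
    rewrite /justified_primrec zi /= => /hasP[[e' [ws w]] wD] /=.
    move=> /and3P[/eqP ee /eqP ews /IHg gz]; subst.
    by apply: eval_PrimRecS gz; apply: (IH _ _ wD).
  have [v [v0 vS ->]] := H _ _ _ yD erefl.
  by exists v; split.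
- have := DP _ yD; rewrite justified_code /justified_mu.
  move=> /andP[/IHf f0 /allP Hz]; split=> // z ltz.
  have zy : z \in iota 0 y by rewrite mem_iota.
  have /hasP[[e [ws w]] wD] /= := Hz z zy.
  move=> /and3P[/eqP ee /eqP ews w0]; subst.
  by exists w.-1; rewrite prednK //; apply: IHf.
Qed.

Lemma sub_justified s (D D' : seq judgment) j :
  {subset D <= D'} -> justified s D j -> justified s D' j.
Proof.
move=> sD; have sub_has (p p' : pred judgment) :
    (forall i : judgment, p i -> p' i) -> has p D -> has p' D'.
  by move=> pp' /hasP[i /sD iD' pi]; apply/hasP; exists i => //; apply: pp'.
case: j => e [xs y]; rewrite /justified; case: (dec e) => tag p.
do 4![case: ifP => // _]; case: ifP => _.
  apply: sub_has => i /and4P[-> -> -> /allP H] /=.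
  by apply/allP => k /H /sD.
case: ifP => _.
  rewrite /justified_primrec; case: ifP => _; first exact: sD.
  by apply: sub_has => i /and3P[-> -> /sD ->].
move=> /andP[-> /andP[/sD yD /allP Hz]]; rewrite /justified_mu yD /=.
by apply/allP => z /Hz; apply: sub_has.
Qed.

Definition derivable A (js : seq judgment) : Prop :=
  exists D k0, {subset js <= D} /\
    forall k, k0 <= k -> derivation (mkseq A k) D.

Lemma derivable_cat A js js' :
  derivable A js -> derivable A js' -> derivable A (js ++ js').
Proof.
move=> [D [k0 [sD HD]]] [D' [k0' [sD' HD']]].
exists (D ++ D'), (maxn k0 k0'); split.
  by move=> j; rewrite !mem_cat => /orP[/sD ->|/sD' ->] //; rewrite orbT.
move=> k; rewrite geq_max => /andP[k1 k2]; rewrite /derivation all_cat.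
apply/andP; split.
  apply: sub_all (HD k k1) => j; apply: sub_justified => i iD.
  by rewrite mem_cat iD.
apply: sub_all (HD' k k2) => j; apply: sub_justified => i iD.
by rewrite mem_cat iD orbT.
Qed.

Lemma derivable_nil A : derivable A [::].
Proof. by exists [::], 0; split. Qed.

Lemma derivable_seq A (js : seq judgment) :
  (forall j, j \in js -> derivable A [:: j]) -> derivable A js.
Proof.
elim: js => [|j js IH] H; first exact: derivable_nil.
rewrite -cat1s; apply: derivable_cat; first by apply: H; rewrite mem_head.
by apply: IH => i ijs; apply: H; rewrite inE ijs orbT.
Qed.

Lemma derivable_step A js j k1 :
  derivable A js -> (forall k, k1 <= k -> justified (mkseq A k) js j) ->
  derivable A [:: j].
Proof.
move=> [D [k0 [sD HD]]] Hj; exists (j :: D), (maxn k0 k1); split.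
  by move=> i; rewrite !inE => ->.
move=> k; rewrite geq_max => /andP[k_0 k_1]; rewrite /derivation /=.
have sub : {subset D <= j :: D} by move=> i iD; rewrite inE iD orbT.
apply/andP; split; first by apply: sub_justified (Hj k k_1) => i /sD /sub.
by apply: sub_all (HD k k_0) => i; apply: sub_justified.
Qed.

Lemma derivation_complete A c xs y :
  eval A c xs y -> derivable A [:: (code_index c, (xs, y))].
Proof.
elim/code_nested_ind: c xs y => [||i||f gs IHf IHgs|f g IHf IHg|f IHf] xs y.
- move=> ->; apply: (derivable_step (k1 := 0) (derivable_nil A)) => k _.
  by rewrite justified_code.
- move=> ->; apply: (derivable_step (k1 := 0) (derivable_nil A)) => k _.
  by rewrite justified_code eqxx.
- move=> ->; apply: (derivable_step (k1 := 0) (derivable_nil A)) => k _.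
  by rewrite justified_code eqxx.
- move=> ->; apply: (derivable_step (k1 := (nth 0 xs 0).+1) (derivable_nil A)).
  move=> k lt_k; rewrite justified_code size_mkseq lt_k.
  by rewrite nth_mkseq ?eqxx.
- move=> /eval_CompP[ys [sys Hg fy]].
  pose js := (code_index f, (ys, y)) ::
    [seq (code_index (nth Zero gs i), (xs, nth 0 ys i)) | i <- iota 0 (size gs)].
  have Hjs : derivable A js.
    apply: derivable_seq => j; rewrite inE => /predU1P[->|]; first exact: IHf.
    move=> /mapP[i]; rewrite mem_iota => /andP[_ lti] ->.
    by apply: IHgs => //; apply: Hg.
  apply: (derivable_step (k1 := 0) Hjs) => k _.
  rewrite justified_code.
  apply/hasP; exists (code_index f, (ys, y)); first by rewrite inE eqxx.
  rewrite /= !eqxx size_map sys eqxx /=; apply/allP => i.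
  rewrite mem_iota => /andP[_ lti]; rewrite (nth_map Zero) // inE.
  by apply/orP; right; apply/mapP; exists i; rewrite ?mem_iota.
- move=> [v [v0 vS ->]]; set e := code_index _.
  suff H i zs : i <= nth 0 xs 0 -> nth 0 zs 0 = i -> behead zs = behead xs ->
      derivable A [:: (e, (zs, v i))] by exact: H.
  elim: i zs => [|i IH] zs le_i zi zb.
    apply: (derivable_step (k1 := 0) (IHf _ _ v0)) => k _.
    rewrite justified_code.
    by rewrite /justified_primrec zi zb inE eqxx.
  have Hi := derivable_cat (IH (i :: behead xs) (ltnW le_i) erefl erefl)
                           (IHg _ _ (vS i le_i)).
  apply: (derivable_step (k1 := 0) Hi) => k _.
  rewrite justified_code.
  rewrite /justified_primrec zi zb /=; apply/orP; left.
  by rewrite !inE !eqxx orbT.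
- move=> [f0 Hz].
  have [w Hw] : exists w, forall z, z < y -> eval A f (z :: xs) (w z).+1.
    have /choice[w Hw] z : exists v, z < y -> eval A f (z :: xs) v.+1.
      by case: (ltnP z y) => [/Hz[v Hv]|_]; [exists v | exists 0].
    by exists w.
  pose js := (code_index f, (y :: xs, 0)) ::
    [seq (code_index f, (z :: xs, (w z).+1)) | z <- iota 0 y].
  have Hjs : derivable A js.
    apply: derivable_seq => j; rewrite inE => /predU1P[->|]; first exact: IHf.
    by move=> /mapP[z]; rewrite mem_iota => /andP[_ ltz] ->; apply/IHf/Hw.
  apply: (derivable_step (k1 := 0) Hjs) => k _.
  rewrite justified_code /justified_mu inE eqxx andTb.
  apply/allP => z zy; apply/hasP; exists (code_index f, (z :: xs, (w z).+1)).
    by rewrite inE; apply/orP; right; apply/mapP; exists z.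
  by rewrite /= !eqxx.
Qed.

(* [certified s e xs y]: some derivation with code below [size s], consulting
   only the oracle bits in [s], shows that program [e] maps [xs] to [y]. *)
Definition certified (s : seq bool) (e : nat) (xs : seq nat) (y : nat) :=
  has (fun d => derivation s (dec d) && ((e, (xs, y)) \in (dec d : seq judgment)))
    (iota 0 (size s)).

Lemma effective_certified (A : Type) (eA : encodable A) (s : A -> seq bool)
    (e : A -> nat) (xs : A -> seq nat) (y : A -> nat) :
  effective s -> effective e -> effective xs -> effective y ->
  effective (fun a => certified (s a) (e a) (xs a) (y a)).
Proof.
move=> es ee exs ey; rewrite /certified; apply: effective_has; last by effectivity.
apply: effective_andb.
  apply: (effective_comp2 effective_derivation); last by effectivity.
  by apply: (effective_comp es); effectivity.
apply: effective_mem; last by effectivity.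
apply: effective_pair; first by apply: (effective_comp ee); effectivity.
apply: effective_pair; first by apply: (effective_comp exs); effectivity.
by apply: (effective_comp ey); effectivity.
Qed.

Lemma certified_sound A k c xs y :
  certified (mkseq A k) (code_index c) xs y -> eval A c xs y.
Proof.
rewrite /certified => /hasP[d _ /andP[HD]]; apply: (derivation_sound _ HD) => i.
by rewrite size_mkseq => lti; rewrite nth_mkseq.
Qed.

Lemma certified_complete A c xs y :
  eval A c xs y ->
  exists k0, forall k, k0 <= k -> certified (mkseq A k) (code_index c) xs y.
Proof.
move=> /derivation_complete[D [k0 [jD HD]]].
exists (maxn k0 (enc D).+1) => k; rewrite geq_max => /andP[k1 k2].
rewrite /certified; apply/hasP; exists (enc D).
  by rewrite mem_iota size_mkseq.
by rewrite encK HD //= jD ?mem_head.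
Qed.

(** * Effectively closed classes *)

Definition strings n : seq (seq bool) :=
  iter n (fun l => map (fun s => rcons s true) l ++ map (fun s => rcons s false) l)
    [:: [::]].

Lemma mem_strings n s : (s \in strings n) = (size s == n).
Proof.
elim: n s => [|n IH] s; first by rewrite inE size_eq0.
rewrite /= mem_cat; case/lastP: s => [|s b].
  by apply/orP => -[] /mapP[[|? ?] ? //].
rewrite size_rcons eqSS -IH; apply/orP/idP.
  by move=> [] /mapP[t tn /rcons_inj[-> _]].
move=> sn.
by case: b; [left | right]; apply/mapP; exists s.
Qed.

Lemma effective_strings (A : Type) (eA : encodable A) (n : A -> nat) :
  effective n -> effective (fun a => strings (n a)).
Proof. by move=> en; rewrite /strings; effectivity. Qed.

Lemma konig (T : seq bool -> Prop) :
  (forall n, exists s, size s = n /\ forall k, k <= n -> T (take k s)) ->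
  exists X, forall k, T (mkseq X k).
Proof.
move=> HT; pose ext s := forall n, exists t,
  size t = n /\ forall k, k <= size s + n -> T (take k (s ++ t)).
have ext0 : ext [::] by move=> n; case: (HT n) => s [<- Hs]; exists s.
have extS s : ext s -> ext (rcons s true) \/ ext (rcons s false).
  move=> es; case: (pselect (ext (rcons s true))) => [|/existsNP[n1 N1]].
    by left.
  case: (pselect (ext (rcons s false))) => [|/existsNP[n2 N2]].
    by right.
  have [[|b t] [//= [st] Ht]] := es (maxn n1 n2).+1.
  have Hb m : m <= maxn n1 n2 -> exists t', size t' = m /\
      forall k, k <= size (rcons s b) + m -> T (take k (rcons s b ++ t')).
    move=> lem; exists (take m t); rewrite size_takel ?st //; split=> // k.
    rewrite size_rcons => lek.
    have E : s ++ b :: t = (rcons s b ++ take m t) ++ drop m t.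
      by rewrite -catA cat_take_drop cat_rcons.
    have := Ht k; rewrite E takel_cat; first by apply; lia.
    by rewrite size_cat size_rcons size_takel ?st.
  by case: b {Ht} Hb => Hb; [case: N1 | case: N2]; apply: Hb;
    rewrite leq_max leqnn ?orbT.
pose fix S n :=
  if n is n'.+1 then rcons (S n') `[< ext (rcons (S n') true) >] else [::].
have extn n : ext (S n).
  by elim: n => //= n /extS; case: asboolP => H1 [].
pose X n := `[< ext (rcons (S n) true) >].
have SX m : mkseq X m = S m by elim: m => [|m IH] //; rewrite mkseqS IH.
exists X => k; have [t [/size0nil -> /(_ k)]] := extn k 0.
by rewrite -SX size_mkseq addn0 cats0 take_oversize ?size_mkseq //; apply.
Qed.

Lemma take_mkseq (X : nat -> bool) k n : k <= n -> take k (mkseq X n) = mkseq X k.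
Proof. by move=> le_kn; rewrite -map_take take_iota (minn_idPl le_kn). Qed.

Definition in_class (B : pred (seq bool)) (X : nat -> bool) : Prop :=
  forall k, B (mkseq X k).

Definition alive (B : pred (seq bool)) n : bool :=
  has (fun s => all (fun k => B (take k s)) (iota 0 n.+1)) (strings n).

Lemma aliveP (B : pred (seq bool)) n :
  reflect (exists s, size s = n /\ forall k, k <= n -> B (take k s)) (alive B n).
Proof.
apply: (iffP hasP) => [[s sn /allP Hs]|[s [sn Hs]]]; exists s.
- move: sn; rewrite mem_strings => /eqP ->; split=> // k le_k.
  by apply: Hs; rewrite mem_iota.
- by rewrite mem_strings sn.
- by apply/allP => k; rewrite mem_iota ltnS => /Hs.
Qed.

Lemma in_class_alive B X n : in_class B X -> alive B n.
Proof.
move=> BX; apply/aliveP; exists (mkseq X n); rewrite size_mkseq; split=> // k.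
by move=> /take_mkseq ->; apply: BX.
Qed.

Lemma alive_in_class B : (forall n, alive B n) -> exists X, in_class B X.
Proof. by move=> aB; apply: (konig (T := B)) => n; apply/aliveP. Qed.

Lemma alive_leq B m n : m <= n -> alive B n -> alive B m.
Proof.
move=> le_mn /aliveP[s [sn Hs]]; apply/aliveP; exists (take m s).
rewrite size_takel ?sn //; split=> // k le_km.
by rewrite take_takel // Hs // (leq_trans le_km).
Qed.

Lemma effective_alive (A : Type) (eA : encodable A) (B : A -> pred (seq bool))
    (n : A -> nat) :
  effective (fun p => B p.1 p.2) -> effective n ->
  effective (fun a => alive (B a) (n a)).
Proof.
move=> eB en; rewrite /alive; apply: effective_has; last exact: effective_strings.
apply: effective_all; last first.
  by apply: (effective_comp (g := fun a => iota 0 (n a).+1)); effectivity.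
by apply: (effective_comp (f := fun p => (p.1.1, take p.2 p.1.2)) eB); effectivity.
Qed.

Definition threshold q := (dec q : nat * nat).1.
Definition side q := (dec q : nat * nat).2 == 0.

(* The members [X] of the class of [B] such that, for each [i < size qs], the
   set computed from [X] by program [e] contains no [x >= threshold q] outside
   the side [side q] of [R i], where [q] is the [i]-th entry of [qs]. *)
Definition constrain (B : pred (seq bool)) (R : nat -> nat -> bool) e
    (qs : seq nat) : pred (seq bool) := fun s =>
  B s && all (fun i => all (fun x =>
      (threshold (nth 0 qs i) <= x) && (R i x != side (nth 0 qs i)) ==>
      ~~ certified s e [:: x] 1) (iota 0 (size s))) (iota 0 (size qs)).

Lemma effective_constrain (A : Type) (eA : encodable A) B R e
    (qs : A -> seq nat) (s : A -> seq bool) :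
  effective B -> effective (fun p => R p.1 p.2) -> effective qs ->
  effective s -> effective (fun a => constrain B R e (qs a) (s a)).
Proof.
move=> eB eR eqs es; rewrite /constrain /threshold /side.
apply: effective_andb; first exact: (effective_comp eB).
apply: effective_all; last by effectivity.
apply: effective_all; last first.
  by apply: (effective_comp (g := fun a => iota 0 (size (s a)))); effectivity.
have eq : effective (fun q : (A * nat) * nat =>
    (dec (nth 0 (qs q.1.1) q.1.2) : nat * nat)).
  apply: effective_dec; apply: effective_nth; last by effectivity.
  by apply: (effective_comp eqs); effectivity.
apply: effective_implb.
  apply: effective_andb; first by effectivity.
  apply: effective_negb; apply: effective_eq; last by effectivity.
  by apply: (effective_comp2 eR); effectivity.
apply: effective_negb; apply: effective_certified; try by effectivity.
by apply: (effective_comp es); effectivity.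
Qed.

Lemma in_constrain B R c qs X :
  in_class (constrain B R (code_index c) qs) X <->
  in_class B X /\ forall i x, i < size qs -> threshold (nth 0 qs i) <= x ->
    R i x != side (nth 0 qs i) -> ~ eval X c [:: x] 1.
Proof.
split=> [H|[BX H] k].
  split=> [k|i x lti lex Rx /certified_complete[k0 Hk]].
    by have /andP[] := H k.
  have /andP[_ /allP Hi] := H (maxn k0 x.+1).
  have ii : i \in iota 0 (size qs) by rewrite mem_iota.
  have xx : x \in iota 0 (size (mkseq X (maxn k0 x.+1))).
    by rewrite mem_iota size_mkseq leq_max ltnSn orbT.
  by have := allP (Hi i ii) x xx; rewrite lex Rx /= Hk // leq_maxl.
apply/andP; split; first exact: BX.
apply/allP => i; rewrite mem_iota => /andP[_ lti]; apply/allP => x _.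
apply/implyP => /andP[lex Rx]; apply/negP => /certified_sound.
exact: H lti lex Rx.
Qed.

Lemma find_iota (p : pred nat) n q :
  q < n -> p q -> (forall r, r < q -> ~~ p r) -> find p (iota 0 n) = q.
Proof.
move=> ltqn pq Hq; have hp : has p (iota 0 n).
  by apply/hasP; exists q; rewrite ?mem_iota.
apply/eqP; rewrite eqn_leq; apply/andP; split; rewrite leqNgt; apply/negP => H.
  by have := before_find 0 H; rewrite nth_iota // pq.
have := nth_find 0 hp.
by rewrite nth_iota ?add0n ?(negPf (Hq _ H)) // (ltn_trans H).
Qed.

(* The guess at stage [s] for the greedy sequence [qs] of length [n] that keeps
   [constrain B R e qs] nonempty. *)
Definition guess B R e s n :=
  iter n (fun qs =>
    rcons qs (find (fun q => alive (constrain B R e (rcons qs q)) s) (iota 0 s)))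
    [::].

Lemma effective_guess (A : Type) (eA : encodable A) B R e (s n : A -> nat) :
  effective B -> effective (fun p => R p.1 p.2) -> effective s -> effective n ->
  effective (fun a => guess B R e (s a) (n a)).
Proof.
move=> eB eR es en; rewrite /guess.
apply: effective_iter => //; last by effectivity.
apply: effective_rcons; first by effectivity.
apply: effective_find; last first.
  by apply: (effective_comp (g := fun a => iota 0 (s a))); effectivity.
apply: effective_alive; last by apply: (effective_comp es); effectivity.
apply: effective_constrain => //; last by effectivity.
by apply: effective_rcons; effectivity.
Qed.

Lemma size_guess B R e s n : size (guess B R e s n) = n.
Proof. by elim: n => //= n IH; rewrite size_rcons IH. Qed.

Lemma nth_guess B R e s n i :
  i < n -> nth 0 (guess B R e s n) i = nth 0 (guess B R e s i.+1) i.
Proof.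
elim: n => // n IH; rewrite ltnS leq_eqVlt => /predU1P[-> //|lti].
rewrite [guess _ _ _ _ n.+1]iterS nth_rcons -/(guess _ _ _ _ _).
by rewrite size_guess lti IH.
Qed.

Lemma guess_limit B R e :
  (exists X, in_class B X) ->
  (forall qs, (exists X, in_class (constrain B R e qs) X) ->
     exists q, exists X, in_class (constrain B R e (rcons qs q)) X) ->
  forall n, exists qs s0, [/\ size qs = n,
    exists X, in_class (constrain B R e qs) X &
    forall s, s0 <= s -> guess B R e s n = qs].
Proof.
move=> [X0 BX0] Hext; elim=> [|n [qs [s0 [sqs neqs Hs0]]]].
  by exists [::], 0; split=> //; exists X0 => k; rewrite /constrain BX0.
pose ne q := `[< exists X, in_class (constrain B R e (rcons qs q)) X >].
have exne : exists q, ne q.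
  by have [q Hq] := Hext qs neqs; exists q; apply/asboolP.
pose q := ex_minn exne.
have [neq minq] : ne q /\ forall r, ne r -> q <= r by rewrite /q; case: ex_minnP.
have /choice[d Hd] r : exists d,
    r < q -> ~~ alive (constrain B R e (rcons qs r)) d.
  case: (ltnP r q) => [ltrq|]; last by exists 0.
  suff /existsNP[d /negP Hd] : ~ forall d, alive (constrain B R e (rcons qs r)) d.
    by exists d.
  by move=> /alive_in_class/asboolP/minq; rewrite leqNgt ltrq.
exists (rcons qs q), (maxn s0 (maxn q.+1 (\max_(r < q) d r))).
split; [by rewrite size_rcons sqs | exact/asboolP |].
move=> s; rewrite !geq_max => /and3P[le_s0 ltqs /bigmax_leqP led].
rewrite /guess iterS -/(guess _ _ _ _ _) (Hs0 s le_s0); congr rcons.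
apply: find_iota => //.
  by have /asboolP[X HX] := neq; apply: in_class_alive HX.
move=> r ltrq; apply: contra (Hd r ltrq) => /alive_leq; apply.
exact: (led (Ordinal ltrq)).
Qed.

(** * Cohesive sets *)

Lemma finite_set_nat_bounded (A : set nat) :
  finite_set A -> exists m, forall x, A x -> x < m.
Proof.
move=> /finite_seqP[s ->]; exists (\max_(x <- s) x).+1 => x /= xs.
by rewrite ltnS; apply: (@leq_bigmax_seq _ s xpredT id).
Qed.

Lemma bounded_finite_set_nat (A : set nat) m :
  (forall x, A x -> x < m) -> finite_set A.
Proof. by move=> H; apply: (sub_finite_set (B := `I_m)). Qed.

Lemma cohesive_unbounded R C n : cohesive R C -> exists2 x, n <= x & C x.
Proof.
move=> [infC _]; apply: contrapT => H; apply: infC.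
apply: (@bounded_finite_set_nat _ n) => x Cx; rewrite ltnNge.
by apply/negP => le_nx; apply: H; exists x.
Qed.

Lemma cohesive_eventually R C n :
  cohesive R C -> exists m b, forall x, m <= x -> C x -> R n x = b.
Proof.
move=> [_ /(_ n)[] /finite_set_nat_bounded[m Hm]]; exists m.
  exists true => x lex Cx; apply: contrapT => Rx.
  by have := Hm x (conj Cx Rx); rewrite ltnNge lex.
exists false => x lex Cx; apply/negbTE/negP => Rx.
by have := Hm x (conj Cx (fun nRx => nRx Rx)); rewrite ltnNge lex.
Qed.

Lemma effective_sequence R :
  computable_sequence R -> effective (fun p => R p.1 p.2).
Proof.
move=> [c Hc]; exists (Comp c [:: nfst_code; nsnd_code]) => -[n x].
apply: (eval_comp2 (Hc n x)).
  by rewrite -[X in eval _ _ _ X](nfst_npair n x); apply: eval_nfst.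
by rewrite -[X in eval _ _ _ X](nsnd_npair n x); apply: eval_nsnd.
Qed.

(* [g s i] is a guess at stage [s] for the side of [R i] on which the cohesive
   set lies. Each new element may use guesses of an arbitrarily late stage,
   which makes the search for it succeed. *)
Lemma limit_computable_cohesive R (g : nat -> nat -> bool) :
  effective (fun p => R p.1 p.2) -> effective (fun p => g p.1 p.2) ->
  (forall n, exists s0, forall s, s0 <= s -> g s n = g s0 n) ->
  (forall n N s0, exists x s, [/\ N <= x, s0 <= s &
     forall i, i < n -> R i x = g s i]) ->
  exists C, computable_set C /\ cohesive R C.
Proof.
move=> eR eg glim gex.
pose good (a : nat * nat) w :=
  [&& a.2 < nfst w, a.1 <= nsnd w &
    all (fun i => R i (nfst w) == g (nsnd w) i)
      (iota 0 a.1)].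
have exgood a : exists w, good a w.
  have [x [s [lex les Hx]]] := gex a.1 a.2.+1 a.1.
  exists (npair x s); rewrite /good nfst_npair nsnd_npair lex les /=.
  by apply/allP => i; rewrite mem_iota => /andP[_ lti]; rewrite Hx.
pose F a := ex_minn (exgood a).
have eF : effective F.
  apply: (effective_search (p := good)).
  - rewrite /good; effectivity.
      by apply: (effective_comp2 eR); effectivity.
    by apply: (effective_comp2 eg); effectivity.
  - by move=> a; rewrite /F; case: ex_minnP.
  - by move=> a m; rewrite /F; case: ex_minnP => w _; apply.
pose elt t := iteri t (fun t x => nfst (F (t, x))) 0.
have eelt : effective elt.
  rewrite /elt; effectivity.
  by apply: (effective_comp eF); effectivity.
have eltS t : elt t < elt t.+1 /\
    exists s, t <= s /\ forall i, i < t -> R i (elt t.+1) = g s i.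
  have : good (t, elt t) (F (t, elt t)) by rewrite /F; case: ex_minnP.
  move=> /and3P[lt_elt les /allP Hi]; split=> //.
  exists (nsnd (F (t, elt t))); split=> // i lti.
  by apply/eqP/Hi; rewrite mem_iota.
have elt_mono : {mono elt : m n / m <= n}.
  apply: leq_mono; apply: homo_ltn; first exact: ltn_trans.
  by move=> t; have [] := eltS t.
have elt_ge t : t <= elt t.
  by elim: t => // t IH; apply: leq_ltn_trans IH _; have [] := eltS t.
pose C (x : nat) := has (fun t => elt t == x) (iota 0 x.+1).
have CP x : C x <-> exists t, x = elt t.
  split=> [/hasP[t _ /eqP <-]|[t ->]]; first by exists t.
  by apply/hasP; exists t; rewrite ?mem_iota //= ltnS elt_ge.
exists C; split.
  have eC : effective C.
    rewrite /C; effectivity.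
    by apply: (effective_comp eelt); effectivity.
  exact: eC.
have elt_side n : exists m b, forall t, m <= t -> R n (elt t) = b.
  have [s0 Hs0] := glim n; exists (maxn s0 n.+1).+1, (g s0 n) => -[//|t].
  rewrite ltnS geq_max => /andP[le_s0 lt_n].
  have [_ [s [le_s ->//]]] := eltS t.
  by rewrite Hs0 // (leq_trans le_s0).
split.
  move=> /finite_set_nat_bounded[m /(_ (elt m))].
  by rewrite ltnNge elt_ge => H; have := H ((CP _).2 (ex_intro _ m erefl)).
move=> n; have [m [b Hb]] := elt_side n.
case: b Hb => Hb; [left | right]; apply: (@bounded_finite_set_nat _ (elt m)) => x.
  move=> /= [/CP[t ->] Rt]; rewrite ltnNge elt_mono; apply/negP => /Hb.
  exact: Rt.
move=> /= [/CP[t ->] Rt]; rewrite ltnNge elt_mono; apply/negP => /Hb Rt'.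
by apply: Rt; rewrite Rt'.
Qed.

(* If every effectively closed subclass of [B] had a member computing a cohesive
   set via [e], then the classes [constrain B R e qs] would follow a cohesive
   set closely enough for the limit of [guess] to yield a computable one. *)
Lemma avoid_cohesive R B e :
  effective (fun p => R p.1 p.2) ->
  ~ (exists C, computable_set C /\ cohesive R C) ->
  effective B -> (exists X, in_class B X) ->
  exists B', [/\ effective B', exists X, in_class B' X &
    forall X, in_class B' X -> in_class B X /\
      forall c C, code_index c = e -> cohesive R C ->
        ~ forall x, eval X c [:: x] (C x)].
Proof.
move=> eR hard eB neB; apply: contrapT => NB.
have H qs : (exists X, in_class (constrain B R e qs) X) ->
    exists X c C, [/\ code_index c = e, in_class (constrain B R e qs) X,
      cohesive R C & forall x, eval X c [:: x] (C x)].
  move=> neq; apply: contrapT => Hqs; apply: NB.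
  exists (constrain B R e qs); split=> //.
    by apply: effective_constrain => //; effectivity.
  move=> X HX; split=> [k|c C ce CC XC]; first by have /andP[] := HX k.
  by apply: Hqs; exists X, c, C.
have Hext qs : (exists X, in_class (constrain B R e qs) X) ->
    exists q, exists X, in_class (constrain B R e (rcons qs q)) X.
  move=> /H[X [c [C [ce XB CC XC]]]]; subst e.
  have [m [b Hb]] := cohesive_eventually (size qs) CC.
  exists (enc (m, if b then 0 else 1)), X.
  have [BX Hqs] := (in_constrain _ _ _ _ _).1 XB.
  apply/in_constrain; split=> // i x; rewrite size_rcons ltnS nth_rcons.
  case: ltngtP => // [lti _|-> _]; first exact: Hqs.
  rewrite /threshold /side encK /= => lex /eqP Rx /eval_functional/(_ (XC x)) Cx.
  have {}Cx : C x by case: (C x) Cx.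
  by apply: Rx; rewrite (Hb x lex Cx); case: (b).
have lim := guess_limit neB Hext.
apply: hard; pose g s i := side (nth 0 (guess B R e s i.+1) i).
apply: (@limit_computable_cohesive R g) => //.
- rewrite /g /side; apply: effective_eq; last by effectivity.
  apply: effective_snd; apply: effective_dec.
  apply: effective_nth; last by effectivity.
  by apply: effective_guess => //; effectivity.
- move=> n; have [qs [s0 [_ _ Hs0]]] := lim n.+1; exists s0 => s les.
  by rewrite /g !Hs0.
- move=> n N s1; have [qs [s0 [sqs /H[X [c [C [ce XB CC XC]]]] Hs0]]] := lim n.
  subst e; have [x lex Cx] := cohesive_unbounded
    (maxn N (\max_(i < n) threshold (nth 0 qs i))) CC.
  move: lex; rewrite geq_max => /andP[leN /bigmax_leqP le_thr].
  exists x, (maxn s0 s1); split; [by [] | exact: leq_maxr |] => i lti.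
  have [_ Hqs] := (in_constrain _ _ _ _ _).1 XB.
  rewrite /g -(nth_guess _ _ _ _ lti) Hs0 ?leq_maxl //.
  apply/eqP; apply: contrapT => /negP Rx; apply: (Hqs i x) => //.
  - by rewrite sqs.
  - exact: (le_thr (Ordinal lti)).
  - by have := XC x; rewrite Cx.
Qed.

(** * An effectively closed class of random sets *)

(* [s] extends a string whose capture by the component [e.+2] of the test coded
   by [e] is witnessed below [size s]. The shift by 2 makes the components sum
   up to measure at most 1/2. *)
Definition hit_now (e : nat) (s : seq bool) :=
  has (fun i => has (fun y => certified (mkseq empty_oracle (size s)) e
      [:: e.+2; string_code (take i s)] y) (iota 0 (size s)))
    (iota 0 (size s).+1).

Definition hit (e : nat) (s : seq bool) :=
  has (fun k => hit_now e (take k s)) (iota 0 (size s).+1).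

(* A program [e] is heeded only as long as this bound holds, which is always if
   it codes a test; this keeps the class of [unhit] nonempty. *)
Definition small e n := count (hit e) (strings n) * 2 ^ e.+2 <= 2 ^ n.

Definition unhit (s : seq bool) :=
  all (fun e => small e (size s) ==> ~~ hit e s) (iota 0 (size s).+1).

Lemma effective_hit (A : Type) (eA : encodable A) (e : A -> nat)
    (s : A -> seq bool) :
  effective e -> effective s -> effective (fun a => hit (e a) (s a)).
Proof.
move=> ee es; rewrite /hit; apply: effective_has; last by effectivity.
have en : effective (fun q : nat * seq bool => hit_now q.1 q.2).
  rewrite /hit_now; effectivity; apply: effective_certified.
  - by rewrite /mkseq /empty_oracle; effectivity.
  - by effectivity.
  - by rewrite /string_code; effectivity.
  - by effectivity.
apply: (effective_comp2 en); first by apply: (effective_comp ee); effectivity.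
by effectivity; apply: (effective_comp es); effectivity.
Qed.

Lemma effective_unhit : effective unhit.
Proof.
rewrite /unhit /small; effectivity.
- by apply: effective_hit; effectivity.
- by apply: effective_strings; effectivity.
- by apply: effective_hit; effectivity.
Qed.

Lemma hit_take e k s : hit e (take k s) -> hit e s.
Proof.
move=> /hasP[j]; rewrite mem_iota ltnS => /andP[_ lej] hj; apply/hasP.
have le_s : size (take k s) <= size s by rewrite size_take_min geq_minr.
exists j; first by rewrite mem_iota ltnS (leq_trans lej).
move: lej; rewrite size_take_min leq_min => /andP[lejk _].
by rewrite take_takel in hj.
Qed.

Lemma size_strings n : size (strings n) = 2 ^ n.
Proof.
by elim: n => //= n IH; rewrite size_cat !size_map IH expnS mul2n addnn.
Qed.

Lemma count_strings_take (p : pred (seq bool)) n :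
  count (fun s => p (take n s)) (strings n.+1) = (count p (strings n)).*2.
Proof.
rewrite [strings _]iterS -/(strings n) count_cat !count_map -addnn.
by congr (_ + _); apply: eq_in_count => s; rewrite mem_strings => /eqP sn;
   rewrite /= -cats1 take_cat -sn ltnn subnn take0 cats0.
Qed.

Definition barred e n (s : seq bool) :=
  has (fun k => small e k && hit e (take k s)) (iota 0 n.+1).

Lemma count_barred e n : count (barred e n) (strings n) * 2 ^ e.+2 <= 2 ^ n.
Proof.
elim: n => [|n IH].
  case: (boolP (small e 0)) => [H|H].
    apply: leq_trans H; rewrite leq_mul2r; apply/orP; right.
    by apply: sub_count => s /hasP[k _ /andP[_]]; apply: hit_take.
  have E : barred e 0 =1 pred0.
    move=> s; apply/negbTE/hasPn => k; rewrite inE => /eqP ->.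
    by rewrite negb_and H.
  by rewrite (eq_count E) count_pred0.
case: (boolP (small e n.+1)) => H.
  apply: leq_trans H; rewrite leq_mul2r; apply/orP; right.
  by apply: sub_count => s /hasP[k _ /andP[_]]; apply: hit_take.
rewrite (eq_count (a2 := fun s => barred e n (take n s))); last first.
  move=> s; rewrite /barred -[n.+2]addn1 iotaD has_cat add0n has_seq1.
  rewrite (negPf H) orbF.
  apply: eq_in_has => k; rewrite mem_iota ltnS => /andP[_ lek].
  by rewrite take_takel.
by rewrite count_strings_take -mul2n -mulnA [2 ^ n.+1]expnS leq_mul2l IH.
Qed.

Lemma alive_unhit n : alive unhit n.
Proof.
pose bad m s := has (fun e => barred e n s) (iota 0 m).
have bound m : count (bad m) (strings n) * 2 ^ m.+1 + 2 ^ n <= 2 ^ n * 2 ^ m.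
  elim: m => [|m IH].
    by rewrite (eq_count (a2 := pred0)) // count_pred0 muln1.
  have le_count : count (bad m.+1) (strings n) <=
      count (bad m) (strings n) + count (barred m n) (strings n).
    rewrite -count_predUI; apply: leq_trans (leq_addr _ _).
    apply: sub_count => s; rewrite /bad -[m.+1]addn1 iotaD has_cat /= orbF.
    by rewrite add0n.
  have := count_barred m n; move: le_count IH.
  rewrite !expnS; move: (count _ _) (count _ _) (count _ _) (2 ^ n) (2 ^ m).
  by move=> a b c u v; nia.
have /hasP[s] : has (predC (bad n.+1)) (strings n).
  rewrite has_predC; apply/negP; rewrite all_count => /eqP E.
  have := bound n.+1; rewrite E size_strings !expnS.
  have := expn_gt0 2 n; move: (2 ^ n) => u; nia.
rewrite mem_strings => /eqP sn /hasPn Hs.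
apply/aliveP; exists s; split=> // k le_k.
apply/allP => e; rewrite size_takel ?sn // mem_iota ltnS => /andP[_ le_e].
apply/implyP => sk; apply/negP => hk.
have en : e \in iota 0 n.+1 by rewrite mem_iota ltnS (leq_trans le_e).
have /hasPn := Hs e en => /(_ k); rewrite mem_iota ltnS le_k sk hk.
by move=> /(_ isT).
Qed.

Import Order.TTheory GRing.Theory Num.Theory.
Local Open Scope classical_set_scope.
Local Open Scope ring_scope.

Definition reals_of (K : realType) (A : set (nat -> bool)) : set K :=
  [set x : K | 0 <= x < 1] `&` @binary_digits K @^-1` A.

Lemma measurable_reals_of_digit (K : realType) n (b : bool) :
  measurable (@reals_of K [set X | X n = b]).
Proof.
have -> : reals_of [set X | X n = b] =
    \bigcup_(m in [set m | odd m = b])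
      ([set` `[0, 1[] `&` [set` `[m%:R / 2 ^+ n.+1, m.+1%:R / 2 ^+ n.+1[])
      :> set K.
  have p0 : 0 < 2 ^+ n.+1 :> K by rewrite exprn_gt0.
  apply/seteqP; split=> x /=; rewrite /reals_of /binary_digits.
    move=> [x01 /= ob]; exists (Num.truncn (2 ^+ n.+1 * x)) => //=.
    rewrite !in_itv /= x01; split=> //.
    rewrite ler_pdivrMr // ltr_pdivlMr // [x * _]mulrC; apply: truncn_itv.
    by case/andP: x01 => x0 _; rewrite mulr_ge0 // ltW.
  move=> [m /= ob]; rewrite !in_itv /= => -[x01 mx]; split=> //=.
  rewrite (_ : Num.truncn _ = m) //; apply: truncn_def.
  by move: mx; rewrite ler_pdivrMr // ltr_pdivlMr // [x * _]mulrC.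
by apply: bigcup_measurable => m _; apply: measurableI; apply: measurable_itv.
Qed.

Lemma measurable_reals_of_cylinder (K : realType) s :
  measurable (@reals_of K (cylinder s)).
Proof.
elim/last_ind: s => [|s b IH].
  rewrite (_ : reals_of _ = [set` `[0, 1[]); first exact: measurable_itv.
  by apply/seteqP; split=> x /=; rewrite in_itv; [case | split].
rewrite (_ : reals_of _ =
    reals_of (cylinder s) `&` reals_of [set X | X (size s) = b]).
  by apply: measurableI => //; apply: measurable_reals_of_digit.
apply/seteqP; split=> x /=.
  move=> [x01 Hx]; split; split=> //=.
    move=> i lti; rewrite (Hx i) ?size_rcons 1?ltnW // nth_rcons lti //.
  by rewrite (Hx (size s)) ?size_rcons // nth_rcons ltnn eqxx.
move=> [[x01 Hx] [_ /= xb]]; split=> // i.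
rewrite size_rcons ltnS leq_eqVlt nth_rcons.
by case/predU1P => [->|lti]; [rewrite ltnn eqxx | rewrite lti; apply: Hx].
Qed.

Lemma measurable_reals_of_open (K : realType) W :
  measurable (@reals_of K (open_of W)).
Proof.
rewrite (_ : reals_of _ =
    \bigcup_s (if `[< W s >] then reals_of (cylinder s) else set0)).
  apply: countable_bigcupT_measurable; first exact: countableP.
  by move=> s; case: ifP => // _; apply: measurable_reals_of_cylinder.
apply/seteqP; split=> x /=.
  by move=> [x01 [s Ws Hx]]; exists s => //; rewrite asboolT.
by move=> [s _]; case: asboolP => // Ws [x01 Hx]; split=> //; exists s.
Qed.

Lemma count_leq_cantor_measure (K : realType) W (p : pred (seq bool)) n :
  (forall s, size s = n -> p s -> exists2 t, W t & t = take (size t) s) ->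
  (((count p (strings n))%:R / 2 ^+ n : K)%:E <= cantor_measure K (open_of W))%E.
Proof.
move=> HW; pose U (l : seq (seq bool)) := \bigcup_(s in [set` l]) cylinder s.
have HU l : uniq l -> all (fun s => size s == n) l ->
    measurable (@reals_of K (U l)) /\
    lebesgue_measure (@reals_of K (U l)) = ((size l)%:R / 2 ^+ n : K)%:E.
  elim: l => [|s l IH].
    rewrite (_ : reals_of _ = set0) ?measure0 ?mul0r //.
    by apply/seteqP; split=> x // [_ []].
  move=> /= /andP[sl ul] /andP[/eqP sn ln]; have [mU EU] := IH ul ln.
  have E : reals_of (U (s :: l)) = @reals_of K (cylinder s) `|` reals_of (U l).
    apply/seteqP; split=> x.
      move=> [x01 [t]] /=; rewrite inE => /predU1P[->|tl] Ht.
        by left.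
      by right; split=> //; exists t.
    move=> [[x01 Hx]|[x01 [t tl Ht]]]; split=> //.
      by exists s => //=; rewrite mem_head.
    by exists t => //=; rewrite inE tl orbT.
  rewrite E; split.
    by apply: measurableU => //; apply: measurable_reals_of_cylinder.
  have -> : lebesgue_measure (@reals_of K (cylinder s) `|` reals_of (U l)) =
      (lebesgue_measure (@reals_of K (cylinder s)) +
       lebesgue_measure (@reals_of K (U l)))%E.
    apply: measureU => //; first exact: measurable_reals_of_cylinder.
    apply/seteqP; split=> x // [[_ Hs] [_ [t tl Ht]]].
    move/negP: sl; apply; rewrite (_ : s = t) //.
    have tn : size t = n by apply/eqP; apply: (allP ln).
    apply: (@eq_from_nth _ false); first by rewrite tn.
    by move=> i lti; rewrite -(Hs i lti) -Ht // tn -sn.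
  rewrite EU; have := cantor_measure_cylinder K s; rewrite /cantor_measure => ->.
  by rewrite sn -EFinD exprVn -[(size l).+1%:R]natr1 mulrDl mul1r addrC.
pose l := [seq s <- strings n | p s].
have ul : uniq l.
  apply: filter_uniq; elim: n {HW HU l} => //= n IH.
  rewrite cat_uniq !map_inj_uniq ?IH //=; try by move=> s t /rcons_inj[].
  rewrite andbT; apply/hasPn => s /mapP[t _ ->].
  by apply/mapP => -[u _ /rcons_inj[]].
have ln : all (fun s => size s == n) l.
  by apply/allP => s; rewrite mem_filter mem_strings => /andP[].
have [mU EU] := HU l ul ln.
rewrite -size_filter -/l -EU; apply: le_measure; rewrite ?inE //.
  exact: measurable_reals_of_open.
move=> x [x01 [s /= sl Hs]]; split=> //; move: sl; rewrite mem_filter mem_strings.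
move=> /andP[ps /eqP sn]; have [t Wt ts] := HW s sn ps; exists t => // i lti.
rewrite Hs; first by rewrite [in RHS]ts nth_take.
by apply: leq_trans lti _; rewrite ts size_take_min geq_minr.
Qed.

Lemma unhit_random (K : realType) X : in_class unhit X -> martin_lof_random K X.
Proof.
move=> HX W [[c Wc] muW] XW; pose e := code_index c.
have hitW s : hit e s -> exists2 t, W e.+2 t & t = take (size t) s.
  move=> /hasP[k _] /hasP[i]; rewrite mem_iota ltnS => /andP[_ lei] /hasP[y _].
  move=> /certified_sound Hy; exists (take i (take k s)).
    by apply/Wc; exists y.
  case: (leqP i k) => leik.
    rewrite take_takel // size_take_min.
    by rewrite -[in LHS](take_size s) take_min.
  rewrite [take i _]take_oversize; last first.
    by rewrite size_take_min (leq_trans (geq_minl _ _)) // ltnW.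
  by rewrite size_take_min -[in LHS](take_size s) take_min.
have sm n : small e n.
  have := count_leq_cantor_measure K (p := hit e) (n := n) (fun s _ => hitW s).
  move=> /le_trans/(_ (muW e.+2)); rewrite lee_fin exprVn.
  rewrite ler_pdivrMr ?exprn_gt0 // mulrC ler_pdivlMr ?exprn_gt0 //.
  by rewrite -!natrX -natrM ler_nat.
have [s Ws Hs] := XW e.+2 I.
have [y /certified_complete[k0 Hk0]] := (Wc e.+2 s).1 Ws.
pose k := maxn (maxn k0 e) (maxn (size s) y.+1).
have [k0k ek sk yk] : [/\ k0 <= k, e <= k, size s <= k & y < k]%N.
  by rewrite /k; split; lia.
have := HX k; rewrite /unhit size_mkseq => /allP/(_ e).
rewrite mem_iota ltnS ek sm => /(_ isT)/negP; apply.
apply/hasP; exists k; first by rewrite mem_iota size_mkseq add0n ltnSn.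
rewrite take_oversize ?size_mkseq //.
apply/hasP; exists (size s); first by rewrite mem_iota size_mkseq ltnS.
apply/hasP; exists y; first by rewrite mem_iota size_mkseq.
rewrite size_mkseq take_mkseq // (_ : mkseq X (size s) = s); first exact: Hk0.
apply: (@eq_from_nth _ false); rewrite size_mkseq // => i lti.
by rewrite nth_mkseq // Hs.
Qed.

Definition nonempty_class (B : pred (seq bool)) : Prop :=
  effective B /\ exists X, in_class B X.

Theorem theorem3p1 (K : realType) (R : nat -> nat -> bool)
    (R_computable : computable_sequence R)
    (R_hard : ~ exists C : nat -> bool, computable_set C /\ cohesive R C) :
  exists X : nat -> bool,
    martin_lof_random K X /\
    ~ exists C : nat -> bool, cohesive R C /\ turing_reducible C X.
Proof.
have eR := effective_sequence R_computable.
have unhit_ne : nonempty_class unhit.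
  by split; [exact: effective_unhit | exact: alive_in_class alive_unhit].
have step (a : nat * {B | nonempty_class B}) : exists B' : {B | nonempty_class B},
    forall X, in_class (sval B') X -> in_class (sval a.2) X /\
      forall c C, code_index c = a.1 -> cohesive R C ->
        ~ forall x, eval X c [:: x] (C x).
  case: a => e [B [eB neB]] /=.
  have [B' [eB' neB' HB']] := avoid_cohesive e eR R_hard eB neB.
  by exists (exist _ B' (conj eB' neB')).
have [next Hnext] := choice step.
pose fix B n : {B | nonempty_class B} :=
  if n is e.+1 then next (e, B e) else exist _ unhit unhit_ne.
have Bdecr m n X : (m <= n)%N ->
    in_class (sval (B n)) X -> in_class (sval (B m)) X.
  move=> /subnK <-; elim: (n - m)%N => //= d IH /Hnext[/IH]; exact.
have [X HX] : exists X, forall n, in_class (sval (B n)) X.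
  have [N|X HX] := @konig (fun s => forall n k,
      (n <= size s)%N -> (k <= size s)%N -> sval (B n) (take k s)) _; last first.
    exists X => n k; have := HX (maxn n k) n k.
    by rewrite size_mkseq leq_maxl leq_maxr take_mkseq ?leq_maxr //; apply.
  case: (svalP (B N)) => _ [X HX]; exists (mkseq X N); rewrite size_mkseq.
  split=> // m le_mN n k; rewrite take_mkseq // size_mkseq => le_nm le_km.
  by rewrite take_mkseq //; apply: (Bdecr n N) => //; apply: leq_trans le_mN.
exists X; split; first exact: unhit_random (HX 0%N).
move=> [C [CC [c Xc]]].
pose e := code_index c.
by have [_ /(_ c C erefl CC)] := Hnext (e, B e) X (HX e.+1).
Qed.
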